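(* Consider a generic normal form game with players $I=\{1,\ldots,N\}$ equipped with an emergent node tree structure (ENT) with tree $T$. Construct a directed graphical model $G$ whose nodes are the nodes of $T$ except the root, with the following edges: for each non-leaf node $v$ of $T$, the children of $v$ form a directed clique in $G$ (edges in both directions between any two distinct children), and from each child of $v$ there is also a directed edge to $v$ (if $v$ is not the root), to each ancestor of $v$ except the root, and to each sibling of $v$ and of those ancestors. For each non-root node $v$ let $d_v=|S_v|-1$, and let $M$ be the square matrix indexed by the pairs $(v,k)$, with $v$ a non-root node and $1\le k\le d_v$, whose entry in row $(v,k)$ and column $(w,l)$ is $\dfrac{1}{(d_w!)^{1/d_w}}$ if $G$ has an edge from $v$ to $w$, and $0$ otherwise. Then the permanent of $M$ (the Bernstein number of the directed graphical model $G$) is an upper bound on the number of totally mixed Nash equilibria of the game which are hierarchically perfect and totally mixed with respect to the ENT.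
   Context: A normal form game has players $I=\{1,\ldots,N\}$, finite pure strategy sets $S_i$ and utilities $u_i\colon\prod_{j}S_j\to\mathbb{R}$, extended multilinearly to mixed strategy profiles $\sigma=(\sigma_i)_i$ ($\sigma_i$ a probability distribution on $S_i$). A profile is totally mixed if all $\sigma_i(s)>0$; it is a Nash equilibrium if no player can increase its expected utility by changing only its own mixed strategy. An emergent node tree structure (ENT) on the game consists of: (a) A rooted tree $T$ whose leaves are in bijection with $I$. For a node $v$, $C_v$ is its set of children and $B_v$ its set of siblings; a leaf $v$ corresponding to player $i$ has $S_v=S_i$. Ancestors are proper ancestors. (b) For each non-leaf, non-root node $v$ (an emergent player), a finite set $S_v$ of pure strategies with $|S_v|\le\prod_{w\in C_v}|S_w|$. (c) For each such $v$, each $s\in S_{C_v}=\prod_{w\in C_v}S_w$ and each $s_{vk}\in S_v$, a probability $p_v(k,s)$ with $\sum_k p_v(k,s)=1$; given mixed strategies of the children, the emergent mixed strategy of $v$ is $\sigma_v(s_{vk})=\sum_{s\in S_{C_v}}p_v(k,s)\prod_{w\in C_v}\sigma_w(s_w)$, computed recursively from the leaves up. The linear map defined by $(p_v(k,s))_{k,s}$ is required to have full rank. (d) For each non-root node $v$, real numbers $\gamma_{vw}$ for each non-root ancestor $w$ of $v$ and real numbers $U_v(s)$ for $s\in S_v\times\prod_{w\in B_v}S_w$. The utility of $v$ is $u_v(\sigma)=U_v(\sigma_v,\sigma_{B_v})+\sum_{w}\gamma_{vw}u_w(\sigma)$, the sum over non-root ancestors $w$ of $v$, where $U_v(\sigma_v,\sigma_{B_v})=\sum_{s}U_v(s)\sigma_v(s_v)\prod_{x\in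 B_v}\sigma_x(s_x)$. For a leaf $v$ corresponding to player $i$, $u_v$ is required to equal $u_i$ (as a function of the strategies of the actual players). A Nash equilibrium $\sigma$ of the game is hierarchically perfect with respect to the ENT if for every emergent player $v$, given the strategies induced by $\sigma$ on the siblings of $v$, the payoff $u_v$ cannot be increased by changing only $\sigma_v$. A profile is totally mixed with respect to the ENT if it is totally mixed and the emergent strategies $\sigma_v$ at all emergent players are also totally mixed. ''Generic'' means: for fixed $T$ and sets $S_v$, for the data $U_v(s),\gamma_{vw},p_v$ of the ENT outside a proper algebraic subset. *)

(* Defs.v *)
From mathcomp Require Import all_boot all_order all_algebra perm.
From mathcomp Require Import classical_sets cardinality reals exp.
From mathcomp Require Import mpoly.

Set Implicit Arguments.
Unset Strict Implicit.
Unset Printing Implicit Defensive.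

Import Order.TTheory GRing.Theory Num.Theory.
Local Open Scope ring_scope.

(* A rooted tree whose leaves are the players 'I_N and whose root is not a
   leaf.  Its nodes are the players, the emergent players, and the root; a
   parent equal to [None] is the root. *)
Record tree (N : nat) := Tree {
  emergent : finType;
  parent : 'I_N + emergent -> option emergent;
  emergent_inner : forall e, exists v, parent v = Some e;
  (* No node is its own proper ancestor, so parent chains end at the root. *)
  parent_acyclic : forall e f, parent (inr e) = Some f ->
    ~~ connect (fun a b => parent (inr a) == Some b) f e
}.

Section TreeNodes.
Context {N : nat} (T : tree N).

(* The nodes other than the root. *)
Definition node : finType := ('I_N + emergent T)%type.

Definition children (o : option (emergent T)) : {set node} :=
  [set v | parent v == o].

Definition siblings (v : node) : {set node} :=
  [set w | (w != v) && (parent w == parent v)].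

(* [anc v e]: e is a proper ancestor of v.  All ancestors other than the root
   are emergent players. *)
Definition anc (v : node) (e : emergent T) : bool :=
  if parent v is Some f
  then connect (fun a b => parent (inr a) == Some b) f e else false.

Definition edge (v w : node) : bool :=
  (w \in siblings v) ||
  [exists e, anc v e && ((w == inr e) || (w \in siblings (inr e)))].

Lemma anc_irr e : ~~ anc (inr e) e.
Proof.
rewrite /anc; case E: (parent (inr e)) => [f|//].
exact: (parent_acyclic E).
Qed.

Lemma anc_trans v e f : anc v e -> anc (inr e) f -> anc v f.
Proof.
rewrite /anc; case: (parent v) => [g|//] ge.
case E: (parent (inr e)) => [h|//] hf.
apply: connect_trans ge _; apply: connect_trans hf.
by apply: connect1; rewrite E.
Qed.

Lemma anc_parent v e : parent v = Some e -> anc v e.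
Proof. by rewrite /anc => ->. Qed.

End TreeNodes.

Section Strategies.
Context {N : nat} {T : tree N}.
Context (A : 'I_N -> finType) (B : emergent T -> finType).

Definition strat (v : node T) : finType :=
  match v with inl i => A i | inr e => B e end.

Definition jprof (X : {set node T}) : finType :=
  {dffun forall w : {w | w \in X}, strat (val w)}.

Definition dim (v : node T) : nat := #|strat v|.-1.

(* The pairs (v, k), with k running over 0 <= k < d_v. *)
Definition eqn_index : finType := {v : node T & 'I_(dim v)}.

Definition bernstein_entry (R : realType) (a b : eqn_index) : R :=
  if edge (tag a) (tag b)
  then 1 / ((dim (tag b))`!%:R `^ (dim (tag b))%:R^-1) else 0.

Definition bernstein_mx (R : realType) : 'M[R]_#|eqn_index| :=
  \matrix_(a, b) bernstein_entry R (enum_val a) (enum_val b).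

End Strategies.

Definition permanent (R : comNzRingType) (n : nat) (M : 'M[R]_n) : R :=
  \sum_(s : 'S_n) \prod_i M i (s i).

Definition is_dist (R : realType) (S : finType) (t : S -> R) : Prop :=
  (forall s, 0 <= t s) /\ \sum_s t s = 1.

Section NormalForm.
Context {R : realType} {N : nat} {A : 'I_N -> finType}.

Definition game := 'I_N -> {dffun forall i, A i} -> R.

Definition profile := forall i : 'I_N, A i -> R.

Definition is_mixed (sg : profile) : Prop := forall i, is_dist (sg i).

Definition expected (u : game) (sg : profile) (i : 'I_N) : R :=
  \sum_(s : {dffun forall i, A i}) u i s * \prod_j sg j (s j).

Definition nash (u : game) (sg : profile) : Prop :=
  is_mixed sg /\
  forall i (t : A i -> R), is_dist t ->
    expected u (dfwith sg t) i <= expected u sg i.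

Definition totally_mixed (sg : profile) : Prop := forall i s, 0 < sg i s.

End NormalForm.
Arguments game R {N} A.
Arguments profile R {N} A.

Section Ent.
Context {R : realType} {N : nat} {T : tree N}.
Context {A : 'I_N -> finType} {B : emergent T -> finType}.
Local Notation S := (strat A B).
Local Notation children_prof e := (jprof A B (children (Some e))).

(* U_v, gamma_vw and p_v(k,s), indexed exactly by their meaningful arguments,
   so that [coords] below lists no spurious parameters. *)
Record ent := Ent {
  own : forall v : node T, S v -> jprof A B (siblings v) -> R;
  gam : forall v : node T, {e | anc v e} -> R;
  prb : forall e : emergent T, S (inr e) -> children_prof e -> R
}.

Definition prb_mx (D : ent) (e : emergent T) :
    'M[R]_(#|S (inr e)|, #|children_prof e|) :=
  \matrix_(k, s) prb D (enum_val k) (enum_val s).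

Definition ent_valid (D : ent) : Prop :=
  (forall e (s : children_prof e), is_dist (fun k => prb D k s)) /\
  (forall e, \rank (prb_mx D e) = minn #|S (inr e)| #|children_prof e|).

Definition node_profile := forall v : node T, S v -> R.

Definition emerge (D : ent) (x : node_profile) (e : emergent T) :
    S (inr e) -> R :=
  fun k => \sum_(s : children_prof e)
    prb D k s * \prod_w x (val w) (s w).

(* Bottom-up evaluation in which the nodes where [pin] is [Some t] play t and
   all others follow the emergence rule.  [evalE] below shows that #|emergent T|
   is enough fuel. *)
Fixpoint eval_rec (D : ent) (n : nat) (pin : forall v, option (S v -> R))
    (v : node T) : S v -> R :=
  match pin v with
  | Some t => t
  | None =>
    match v with
    | inl i => fun=> 0
    | inr e => if n is n'.+1 then emerge D (eval_rec D n' pin) (e := e)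
               else fun=> 0
    end
  end.

Definition eval D pin : node_profile := eval_rec D #|emergent T| pin.

Definition pin_players (sg : profile R A) (v : node T) : option (S v -> R) :=
  match v with inl i => Some (sg i) | inr e => None end.

Definition induced (D : ent) (sg : profile R A) : node_profile :=
  eval D (pin_players sg).

(* The strategies of all nodes when e alone switches to t: nothing changes
   except at e and, through emergence, at its ancestors. *)
Definition deviation (D : ent) (sg : profile R A) (e : emergent T)
    (t : S (inr e) -> R) : node_profile :=
  eval D (dfwith (pin_players sg) (i := inr e) (Some t)).

Lemma eval_rec_stable (D : ent) pin (e : emergent T) m n (k : S (inr e)) :
  (#|[set f | anc (inr f) e]| < m)%N -> (#|[set f | anc (inr f) e]| < n)%N ->
  eval_rec D m pin k = eval_rec D n pin k.
Proof.
elim: m n e k => [|m IH] [|n] e k //= hm hn.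
case: (pin _) => //; apply: eq_bigr => s _; congr (_ * _).
apply: eq_bigr => -[[i|f] /= wP] _; first by case: m n {IH hm hn} => [|m] [|n].
have fe : parent (inr f) = Some e by move: (wP); rewrite inE => /eqP.
have lt : (#|[set g | anc (inr g) f]| < #|[set g | anc (inr g) e]|)%N.
  apply: proper_card; apply/fintype.properP; split.
    by apply/fintype.subsetP => g; rewrite !inE => /anc_trans; apply; apply: anc_parent.
  by exists f; rewrite !inE ?anc_irr // anc_parent.
by apply: IH; apply: leq_trans lt _.
Qed.

Lemma evalE (D : ent) pin (v : node T) (k : S v) :
  eval D pin k =
    match pin v with
    | Some t => t k
    | None =>
      match v return S v -> R with
      | inl i => fun=> 0
      | inr e => emerge D (eval D pin) (e := e)
      end k
    end.
Proof.
case: v k => [i|e] k.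
  by rewrite /eval; case: #|emergent T| => [|n] /=; case: (pin _).
have lt : (#|[set f | anc (inr f) e]| < #|emergent T|)%N.
  rewrite -cardsT; apply: proper_card; apply/fintype.properP; split; first exact: finset.subsetT.
  by exists e; rewrite !inE // anc_irr.
by rewrite /eval (@eval_rec_stable D pin e _ #|emergent T|.+1) //=; [case: (pin _) | apply: leq_trans lt _].
Qed.

Definition own_utility (D : ent) (x : node_profile) (v : node T) : R :=
  \sum_(k : S v) \sum_(s : jprof A B (siblings v))
    own D k s * x v k * \prod_w x (val w) (s w).

(* Top-down recursion; [utilityE] below shows that the fuel suffices. *)
Fixpoint utility_rec (D : ent) (n : nat) (x : node_profile) (v : node T) : R :=
  own_utility D x v +
  (if n is n'.+1
   then \sum_(e : {e | anc v e}) gam D e * utility_rec D n' x (inr (val e))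
   else 0).

Definition utility (D : ent) (x : node_profile) (v : node T) : R :=
  utility_rec D #|emergent T| x v.

Lemma utility_rec_stable (D : ent) x v m n :
  (#|[set e | anc v e]| <= m)%N -> (#|[set e | anc v e]| <= n)%N ->
  utility_rec D m x v = utility_rec D n x v.
Proof.
have none w : (#|[set e | anc w e]| <= 0)%N -> forall F : {e | anc w e} -> R,
    \sum_e F e = 0.
  rewrite leqn0 cards_eq0 => /eqP w0 F; apply: big1 => -[e we] _.
  by have := finset.in_set0 e; rewrite -w0 inE we.
elim: m n v => [|m IH] [|n] v //= hm hn; congr (_ + _).
- by rewrite none.
- by rewrite none.
apply: eq_bigr => -[e ve] _ /=; congr (_ * _).
have lt : (#|[set f | anc (inr e) f]| < #|[set f | anc v f]|)%N.
  apply: proper_card; apply/fintype.properP; split.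
    by apply/fintype.subsetP => f; rewrite !inE; apply: anc_trans.
  by exists e; rewrite !inE // anc_irr.
by apply: IH; rewrite -ltnS; apply: leq_trans lt _.
Qed.

Lemma utilityE (D : ent) x v :
  utility D x v = own_utility D x v +
    \sum_(e : {e | anc v e}) gam D e * utility D x (inr (val e)).
Proof.
rewrite /utility (@utility_rec_stable D x v _ #|emergent T|.+1) //=.
  exact: max_card.
by apply: leq_trans (max_card _) _.
Qed.

Definition ent_on (u : game R A) (D : ent) : Prop :=
  ent_valid D /\
  forall sg, is_mixed sg -> forall i,
    utility D (induced D sg) (inl i) = expected u sg i.

Definition hier_perfect (D : ent) (sg : profile R A) : Prop :=
  forall e (t : S (inr e) -> R), is_dist t ->
    utility D (deviation D sg t) (inr e) <= utility D (induced D sg) (inr e).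

Definition ent_totally_mixed (D : ent) (sg : profile R A) : Prop :=
  totally_mixed sg /\ forall e (k : S (inr e)), 0 < induced D sg k.

Definition coord : finType :=
  ({v : node T & (S v * jprof A B (siblings v))%type}
   + {v : node T & {e | anc v e}}
   + {e : emergent T & (S (inr e) * children_prof e)%type})%type.

Definition coords (D : ent) (c : coord) : R :=
  match c with
  | inl (inl (existT v ks)) => own D ks.1 ks.2
  | inl (inr (existT v e)) => gam D e
  | inr (existT e ks) => prb D ks.1 ks.2
  end.

Definition algebraic (K : finType) (Z : set (K -> R)) : Prop :=
  exists ps : seq {mpoly R[#|K|]},
    Z = [set x | all (fun p => p.@[fun i => x (enum_val i)] == 0) ps]%classic.

(* Properness is relative to the space of all valid data, on which the
   normalization of the probabilities holds identically. *)
Definition generically (P : ent -> Prop) : Prop :=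
  exists Z : set (coord -> R),
    [/\ algebraic Z,
        exists D, ent_valid D /\ ~ Z (coords D) &
        forall D, ent_valid D -> ~ Z (coords D) -> P D].

End Ent.
Arguments ent R {N T} A B.

(* Main.v *)
(* At a totally mixed, hierarchically perfect equilibrium, a top-down induction
   shows that the utility of each ancestor of v does not change when v deviates.
   So v is indifferent between its pure strategies as far as U_v is concerned,
   and the strategies of all nodes solve d_v multilinear equations per node v
   which involve only the siblings of v.

   Let B be the number of maps c from the equations to the nodes that send each
   equation of v to a sibling of v and hit each node w exactly d_w times.  If
   every equation is a product of linear forms, one per sibling and in general
   position, then splitting the products one factor at a time shows that the
   ideal has corank at most B in each large multidegree.  This is a rank
   condition on a Macaulay matrix, hence it holds for generic data.  Evaluations
   at distinct solutions are independent functionals that vanish on the ideal,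
   so there are at most B solutions.

   Each c is induced by at least prod_w d_w! permutations of the pairs (v, k),
   and each of them contributes prod_w 1 / d_w! to the permanent. *)
Require Import Defs.
From mathcomp Require Import all_boot all_order all_algebra perm.
From mathcomp Require Import classical_sets cardinality reals exp boolp functions.
From mathcomp Require Import mpoly.
From mathcomp Require Import zify.
Set Implicit Arguments.
Unset Strict Implicit.
Unset Printing Implicit Defensive.
Import Order.TTheory GRing.Theory Num.Theory.
Local Open Scope ring_scope.

(** * Polynomials graded by groups of variables *)

Section MultihomogeneousPolynomials.
Context {R : numFieldType} {G : finType} (S : G -> finType).
Local Notation nV := #|{: {w : G & S w}}|.
Local Notation poly := {mpoly R[nV]}.
Local Notation mono := 'X_{1..nV}.

Definition pvar (w : G) (a : S w) : poly := 'X_(enum_rank (Tagged S a)).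

Definition gdeg (w : G) (mu : mono) : nat :=
  (\sum_(a : S w) mu (enum_rank (Tagged S a)))%N.

(* Degrees are integers, so that differences of degrees are never truncated. *)
Definition mhomog (m : G -> int) (p : poly) : bool :=
  all (fun mu => [forall w, (gdeg w mu)%:Z == m w]) (msupp p).

(* Vandermonde forms: any #|S w| of them with distinct parameters span the
   variables of group w. *)
Definition linf (t : R) (w : G) : poly :=
  \sum_(a : S w) t ^+ enum_rank a *: pvar a.

Lemma mhomogP m p :
  reflect (forall mu, mu \in msupp p -> forall w, (gdeg w mu)%:Z = m w) (mhomog m p).
Proof.
apply: (iffP allP) => h mu /h; first by move=> /forallP e w; apply/eqP.
by move=> e; apply/forallP => w; apply/eqP.
Qed.

Lemma eq_mhomog m m' p : m =1 m' -> mhomog m p -> mhomog m' p.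
Proof. by move=> e /mhomogP h; apply/mhomogP => mu /h hm w; rewrite hm. Qed.

Lemma gdegD w mu nu : gdeg w (mu + nu)%MM = (gdeg w mu + gdeg w nu)%N.
Proof. by rewrite /gdeg -big_split; apply: eq_bigr => a _; rewrite mnmDE. Qed.

Lemma gdeg1 w v (a : S v) : gdeg w U_(enum_rank (Tagged S a))%MM = (w == v).
Proof.
rewrite /gdeg; under eq_bigr do rewrite mnm1E (inj_eq enum_rank_inj).
case: (w =P v) => [ewv|nwv]; last first.
  rewrite big1 // => b _; case: eqP => // e.
  by have := congr1 tag e => /= /esym.
case: v / ewv a => a; rewrite (bigD1 a) //= eqxx big1 // => b nba.
by rewrite eq_Tagged /= eq_sym (negPf nba).
Qed.

Lemma mhomog0 m : mhomog m 0.
Proof. by apply/mhomogP => mu; rewrite msupp0. Qed.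

Lemma mhomog1 : mhomog (fun=> 0) 1.
Proof.
apply/mhomogP => mu; rewrite msupp1 inE => /eqP -> w.
by rewrite /gdeg big1 // => a _; rewrite mnm0E.
Qed.

Lemma mhomogD m p q : mhomog m p -> mhomog m q -> mhomog m (p + q).
Proof.
move=> /mhomogP hp /mhomogP hq; apply/mhomogP => mu /msuppD_le.
by rewrite mem_cat => /orP [/hp|/hq].
Qed.

Lemma mhomogZ m a p : mhomog m p -> mhomog m (a *: p).
Proof. by move=> /mhomogP hp; apply/mhomogP => mu /msuppZ_le /hp. Qed.

Lemma mhomog_sum m (I : Type) (r : seq I) (P : pred I) (F : I -> poly) :
  (forall i, P i -> mhomog m (F i)) -> mhomog m (\sum_(i <- r | P i) F i).
Proof.
move=> h; elim/big_rec: _ => [|i p /h hi hp]; first exact: mhomog0.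
exact: mhomogD.
Qed.

Lemma mhomogM m m' p q : mhomog m p -> mhomog m' q ->
  mhomog (fun w => m w + m' w) (p * q).
Proof.
move=> /mhomogP hp /mhomogP hq; apply/mhomogP => mu /msuppM_le.
case/allpairsP => -[m1 m2] /= [h1 h2 ->] w.
by rewrite gdegD PoszD hp // hq.
Qed.

Lemma mhomog_var w (a : S w) : mhomog (fun v => (v == w)%:Z) (pvar a).
Proof.
by apply/mhomogP => mu; rewrite msuppX inE => /eqP -> v; rewrite gdeg1.
Qed.

Lemma mhomog_linf t w : mhomog (fun v => (v == w)%:Z) (linf t w).
Proof. by apply: mhomog_sum => a _; apply: mhomogZ; apply: mhomog_var. Qed.

Lemma mhomog_prod (I : finType) (P : pred I) (m : I -> G -> int) (F : I -> poly) :
  (forall i, P i -> mhomog (m i) (F i)) ->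
  mhomog (fun w => \sum_(i | P i) m i w) (\prod_(i | P i) F i).
Proof.
move=> h; rewrite -!(big_filter _ P).
under [in X in mhomog X]eq_fun do rewrite -(big_filter _ P).
have : all P (filter P (index_enum I)) by exact: filter_all.
elim: (filter _ _) => [_|i r IH /= /andP [Pi Pr]].
  rewrite big_nil; apply: eq_mhomog mhomog1 => w; by rewrite big_nil.
rewrite big_cons; apply: eq_mhomog (mhomogM (h _ Pi) (IH Pr)) => w.
by rewrite big_cons.
Qed.

(** The coefficients [b] solve a linear system whose matrix is Vandermonde, hence invertible for
    distinct parameters. *)
Lemma pvar_linf w (t : 'I_#|S w| -> R) (a : S w) : injective t ->
  exists b : 'I_#|S w| -> R, pvar a = \sum_i b i *: linf (t i) w.
Proof.
move=> tI; pose M := Vandermonde #|S w| (\row_i t i).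
have uM : M \in unitmx.
  rewrite unitmxE det_Vandermonde unitfE; apply/prodf_neq0 => i _.
  apply/prodf_neq0 => j lij; rewrite !mxE subr_eq0; apply/eqP => /tI e.
  by rewrite e ltnn in lij.
pose d : 'cV[R]_#|S w| := \col_i (i == enum_rank a)%:R.
exists (fun i => (invmx M *m d) i 0).
transitivity (\sum_(c : S w) (M *m (invmx M *m d)) (enum_rank c) 0 *: pvar c).
  rewrite mulKVmx // (bigD1 a) //= mxE eqxx scale1r big1 ?addr0 // => c nca.
  by rewrite mxE (inj_eq enum_rank_inj) (negPf nca) scale0r.
under [RHS]eq_bigr do rewrite scaler_sumr.
rewrite exchange_big; apply: eq_bigr => c _ /=.
rewrite mxE scaler_suml; apply: eq_bigr => i _.
by rewrite !mxE scalerA mulrC.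
Qed.

(** Since [m w] is positive, every monomial of [p] contains a variable of group [w], which can be
    split off; this lowers the degree in [w] by one. *)
Lemma mhomog_ind m w (Q : poly -> Prop) :
  0 < m w -> Q 0 -> (forall p q, Q p -> Q q -> Q (p + q)) ->
  (forall (a : S w) p, mhomog (fun v => m v - (v == w)%:Z) p -> Q (pvar a * p)) ->
  forall p, mhomog m p -> Q p.
Proof.
move=> mw Q0 QD QX p /mhomogP hp.
rewrite (mpolyE p) big_seq; elim/big_rec: _ => // mu q hmu Qq.
apply: QD => //; have dw := hp _ hmu w.
have [a ha] : exists a, (0 < mu (enum_rank (Tagged S (a : S w))))%N.
  apply/existsP; rewrite -[X in is_true X]negbK negb_exists; apply/negP => /forallP h.
  move: mw; rewrite -dw ltz_nat /gdeg big1 // => a _; apply/eqP.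
  by have := h a; rewrite -leqNgt leqn0.
have e : mu = (U_(enum_rank (Tagged S a)) + (mu - U_(enum_rank (Tagged S a))))%MM.
  by rewrite addmC submK // lep1mP -lt0n.
rewrite {2}e mpolyXD scalerAr; apply: QX; apply: mhomogZ.
apply/mhomogP => nu; rewrite msuppX inE => /eqP -> v.
by rewrite -(hp _ hmu v) {2}e gdegD gdeg1 PoszD addrAC subrr add0r.
Qed.

Lemma mhomog_const p : mhomog (fun=> 0) p -> p = (p@_0%MM)%:MP.
Proof.
move=> /mhomogP hp; rewrite -alg_mpolyC.
apply/mpolyP => mu; rewrite mcoeffZ mcoeff1.
case: (altP (mu =P 0%MM)) => [->|nz]; first by rewrite mulr1.
rewrite mulr0; apply: memN_msupp_eq0; apply: contra nz => /hp h.
apply/eqP/mnmP => i; rewrite mnm0E.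
have [] := h (tag (enum_val i)); rewrite /gdeg (bigD1 (tagged (enum_val i))) //=.
by case: (enum_val i) (enum_valK i) => v a /= -> /eqP; rewrite addn_eq0 => /andP [/eqP].
Qed.

Lemma mhomog_neg m w p : m w < 0 -> mhomog m p -> p = 0.
Proof.
move=> mw /mhomogP hp; apply/mpolyP => mu; rewrite mcoeff0.
by apply: memN_msupp_eq0; apply/negP => /hp /(_ w) e; rewrite -e in mw.
Qed.

End MultihomogeneousPolynomials.

(** * Corank of ideals generated by products of linear forms *)

Section CorankBound.
Context {R : numFieldType} {G : finType} (S : G -> finType) {J : finType}.
Context (th : J -> R).
Hypothesis th_inj : injective th.
Hypothesis th_neq0 : forall j, th j != 0.
Hypothesis S_gt0 : forall w, (0 < #|S w|)%N.
Hypothesis cardJ : #|J| = (\sum_w #|S w|.-1)%N.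
Local Notation nV := #|{: {w : G & S w}}|.
Local Notation poly := {mpoly R[nV]}.
Implicit Types (m : G -> int) (W : J -> {set G}).

(** With [d_w = #|S w|.-1], their number is the coefficient of the product of all [x_w ^ d_w] in
    [\prod_j \sum_(w in W j) x_w], a multihomogeneous Bezout number. *)
Definition assignments W : {set {ffun J -> G}} :=
  [set c : {ffun J -> G} | [forall j, c j \in W j]
     & [forall w, #|[set j | c j == w]| == #|S w|.-1]].

(** One parameter [th j] serves all groups, since general position matters only among forms of the
    same group. *)
Definition gen W (j : J) : poly := \prod_(w in W j) linf S (th j) w.

(** Cofactors of complementary degree turn membership into finite-dimensional linear algebra. *)
Definition in_ideal m W (p : poly) : Prop :=
  exists h : J -> poly,
    (forall j, mhomog (fun w => m w - (w \in W j)%:Z) (h j)) /\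
    p = \sum_j h j * gen W j.

(** This bounds by [b] the multigraded Hilbert function of the quotient ring at [m]. *)
Definition corank_le m W (b : nat) : Prop :=
  exists q : 'I_b -> poly, forall p, mhomog m p ->
    exists a : 'I_b -> R, in_ideal m W (p - \sum_i a i *: q i).

Lemma in_ideal0 m W : in_ideal m W 0.
Proof.
exists (fun=> 0); split=> [j|]; first exact: mhomog0.
by rewrite big1 // => j _; rewrite mul0r.
Qed.

Lemma in_idealD m W p q : in_ideal m W p -> in_ideal m W q -> in_ideal m W (p + q).
Proof.
move=> [h [hh ->]] [k [hk ->]]; exists (fun j => h j + k j); split=> [j|].
  exact: mhomogD.
by rewrite -big_split; apply: eq_bigr => j _; rewrite mulrDl.
Qed.

Lemma in_idealM m m' W f p : mhomog m' f -> in_ideal m W p ->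
  in_ideal (fun w => m' w + m w) W (f * p).
Proof.
move=> hf [h [hh ->]]; exists (fun j => f * h j); split=> [j|].
  by apply: eq_mhomog (mhomogM hf (hh j)) => w; rewrite addrA.
by rewrite mulr_sumr; apply: eq_bigr => j _; rewrite mulrA.
Qed.

Lemma eq_in_ideal m m' W p : m =1 m' -> in_ideal m W p -> in_ideal m' W p.
Proof.
move=> e [h [hh ->]]; exists h; split=> // j.
by apply: eq_mhomog (hh j) => w; rewrite e.
Qed.

Lemma in_idealZ m W a p : in_ideal m W p -> in_ideal m W (a *: p).
Proof.
rewrite -mul_mpolyC => /(in_idealM (m' := fun=> 0)) h.
apply: eq_in_ideal (h _ _) => [w|]; first by rewrite add0r.
by rewrite -alg_mpolyC; apply: mhomogZ; apply: mhomog1.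
Qed.

Lemma in_ideal_sum m W (I : finType) (P : pred I) (F : I -> poly) :
  (forall i, P i -> in_ideal m W (F i)) -> in_ideal m W (\sum_(i | P i) F i).
Proof.
move=> h; elim/big_rec: _ => [|i p /h hi hp]; first exact: in_ideal0.
exact: in_idealD.
Qed.

Lemma in_ideal_gen m W j f : mhomog (fun w => m w - (w \in W j)%:Z) f ->
  in_ideal m W (f * gen W j).
Proof.
move=> hf; exists (fun i => if i == j then f else 0); split=> [i|].
  by case: eqP => [->|_] //; apply: mhomog0.
by rewrite (bigD1 j) //= eqxx big1 ?addr0 // => i /negPf ->; rewrite mul0r.
Qed.

Lemma pvar_linf_set w (K : finType) (t : K -> R) (E : {set K}) (a : S w) :
  injective t -> (#|S w| <= #|E|)%N ->
  exists b : K -> R, (pvar a : poly) = \sum_(k in E) b k *: linf S (t k) w.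
Proof.
move=> tI le; pose f i := enum_val (widen_ord le i).
have fI : injective (fun i => t (f i)).
  by move=> i j /tI /enum_val_inj /(congr1 val) /= /val_inj.
have [b hb] := pvar_linf a fI.
(* As [f] is injective, each of these sums has at most one term. *)
exists (fun k => \sum_(i | f i == k) b i).
rewrite hb (partition_big f (mem E)) => [|i _]; last exact: enum_valP.
apply: eq_bigr => k _; rewrite scaler_suml.
by apply: eq_bigr => i /eqP ->.
Qed.

(** * The case where every generator is a single linear form *)

Section SingletonSets.
Context (c : {ffun J -> G}).
Let W j := [set c j].

Lemma gen_set1 j : gen W j = linf S (th j) (c j).
Proof. by rewrite /gen big_set1. Qed.

Lemma in_ideal_linf m w f j : c j = w -> mhomog (fun v => m v - (v == w)%:Z) f ->
  in_ideal m W (linf S (th j) w * f).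
Proof.
move=> <- hf; rewrite mulrC -gen_set1; apply: in_ideal_gen.
by apply: eq_mhomog hf => v; rewrite inE.
Qed.

(** The forms available in group [w] span all its variables, so the ideal contains everything of
    positive degree in [w]. *)
Lemma corank_overdetermined m w : (#|S w| <= #|[set j | c j == w]|)%N ->
  0 < m w -> corank_le m W 0.
Proof.
move=> le mw; exists (fun=> 0) => p hp; exists (fun=> 0).
rewrite big_ord0 subr0; move: p hp; apply: (mhomog_ind mw) => [|p q|a p hp].
- exact: in_ideal0.
- exact: in_idealD.
have [b ->] := pvar_linf_set a th_inj le.
rewrite mulr_suml; apply: in_ideal_sum => j; rewrite inE => /eqP cj.
by rewrite -scalerAl; apply: in_idealZ; apply: in_ideal_linf.
Qed.

(** The [#|S w|.-1] forms of group [w] lack one element of a basis. The form with parameter 0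
    completes it, because no [th j] is 0. *)
Lemma pvar_mod_linf w (a : S w) : #|[set j | c j == w]| = #|S w|.-1 ->
  exists (b0 : R) (b : J -> R), (pvar a : poly) =
    b0 *: linf S 0 w + \sum_(j | c j == w) b j *: linf S (th j) w.
Proof.
move=> cw; pose t o := if o is Some j then th j else 0.
have tI : injective t.
  move=> [j|] [k|] //= => [/th_inj ->|e|/esym e] //; first by have := th_neq0 j; rewrite e eqxx.
  by have := th_neq0 k; rewrite e eqxx.
pose E := None |: [set Some j | j in [set j | c j == w]].
have nE : None \notin [set Some j | j in [set j | c j == w]] by apply/imsetP => -[].
have cE : (#|S w| <= #|E|)%N.
  rewrite cardsU1 nE card_imset; last exact: Some_inj.
  by rewrite cw add1n prednK.
have [b ->] := pvar_linf_set a tI cE.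
exists (b None), (fun j => b (Some j)).
rewrite big_setU1 //= big_imset /=; last by move=> ? ? _ _ [].
by congr (_ + _); apply: eq_bigl => j; rewrite inE.
Qed.

(** Modulo the ideal every variable of group [w] is a multiple of [linf S 0 w], so every form
    reduces to a multiple of one product of such forms. Geometrically, the linear forms cut out a
    single point. *)
Lemma corank_exact m : (forall w, #|[set j | c j == w]| = #|S w|.-1) ->
  corank_le m W 1.
Proof.
(* The absolute value only makes the exponent a natural number; if some [m w] is negative, then [p]
   is 0 and the coefficient 0 is chosen. *)
move=> cw; pose q m : poly := \prod_w linf S 0 w ^+ `|m w|%N.
exists (fun=> q m) => p hp.
suff [a ha] : exists a : R, in_ideal m W (p - a *: q m).
  by exists (fun=> a); rewrite big_ord1.
elim: {m}_.+1 {-2}m (ltnSn (\sum_w `|m w|)%N) p hp => // n IH m; rewrite ltnS => le p hp.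
have [[w mw]|hm] := pselect (exists w, m w < 0).
  by exists 0; rewrite scale0r subr0 (mhomog_neg mw hp); apply: in_ideal0.
have [[w mw]|hm'] := pselect (exists w, 0 < m w); last first.
  have m0 w : m w = 0.
    by case: (ltgtP (m w) 0) => // h; [case: hm | case: hm']; exists w.
  have hp0 : mhomog (fun=> 0) p by apply: eq_mhomog hp.
  exists p@_0%MM; have -> : q m = 1 by rewrite /q big1 // => w _; rewrite m0.
  rewrite {1}(mhomog_const hp0) alg_mpolyC subrr; exact: in_ideal0.
move: p hp; apply: (mhomog_ind mw) => [|p1 p2 [a1 h1] [a2 h2]|a p hp].
- by exists 0; rewrite scale0r subr0; apply: in_ideal0.
- exists (a1 + a2); have := in_idealD h1 h2.
  by rewrite scalerDl opprD addrACA.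
pose m' v := m v - (v == w)%:Z.
have [|a0 h0] := IH m' _ p hp.
  apply: leq_trans le; rewrite (bigD1 w) // [X in (_ < X)%N](bigD1 w) //=.
  rewrite -addSn leq_add //.
    by rewrite /m' eqxx; move: mw; lia.
  by apply: leq_sum => v /negPf nvw; rewrite /m' nvw subr0.
have [b0 [b ->]] := pvar_mod_linf a (cw w).
have qE : q m = linf S 0 w * q m'.
  rewrite /q (bigD1 w) //= [in RHS](bigD1 w) //= mulrA -exprS; congr (_ ^+ _ * _).
    by rewrite /m' eqxx; move: mw; lia.
  by apply: eq_bigr => v /negPf nvw; rewrite /m' nvw subr0.
(* The terms with parameters [th j] lie in the ideal; the term with parameter 0 is handled by the
   induction hypothesis in degree [m']. *)
exists (b0 * a0); rewrite mulrDl addrAC; apply: in_idealD; last first.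
  rewrite mulr_suml; apply: in_ideal_sum => j /eqP cj.
  by rewrite -scalerAl; apply: in_idealZ; apply: in_ideal_linf.
rewrite -scalerAl -scalerA -scalerBr; apply: in_idealZ.
rewrite qE scalerAr -mulrBr.
apply: eq_in_ideal (in_idealM (mhomog_linf S 0 w) h0) => v.
by rewrite /m' addrC subrK.
Qed.

(** Either all fibres of [c] have the prescribed sizes, and [c] is the only assignment, or some
    group receives too many forms, and both the corank and the number of assignments are 0. *)
Lemma corank_set1 m : (forall w, (#|[set j | w \in W j]|)%:Z <= m w) ->
  corank_le m W #|assignments W|.
Proof.
move=> hm.
have eW w : [set j | w \in W j] = [set j | c j == w].
  by apply/setP => j; rewrite !inE eq_sym.
case: (boolP [forall w, #|[set j | c j == w]| == #|S w|.-1]) => hc.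
  rewrite (_ : assignments W = [set c]); last first.
    apply/setP => d; rewrite !inE; apply/andP/eqP => [[/forallP h _]|->].
      by apply/ffunP => j; have := h j; rewrite inE => /eqP.
    by split=> //; apply/forallP => j; rewrite inE.
  by rewrite cards1; apply: corank_exact => w; apply/eqP/(forallP hc).
(* By [cardJ] the fibre sizes and the prescribed sizes have the same sum, so a mismatch forces some
   fibre to be too large. *)
have [w hw] : exists w, (#|S w|.-1 < #|[set j | c j == w]|)%N.
  apply/existsP; apply: contraNT hc; rewrite negb_exists => /forallP h.
  have le w : (#|[set j | c j == w]| <= #|S w|.-1)%N by rewrite leqNgt.
  have tot : (\sum_w #|[set j | c j == w]| = \sum_w #|S w|.-1)%N.
    rewrite -cardJ -sum1_card (partition_big c predT) //; apply: eq_bigr => w _.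
    by rewrite -sum1_card; apply: eq_bigl => j; rewrite inE.
  have [_] := leqif_sum (fun w (_ : true) => leqif_eq (le w)).
  by rewrite tot eqxx => /esym.
have -> : #|assignments W| = 0%N.
  apply/eqP; rewrite cards_eq0 -finset.subset0; apply/fintype.subsetP => d.
  rewrite inE => /andP [/forallP h /forallP /(_ w)].
  have -> : d = c by apply/ffunP => j; have := h j; rewrite inE => /eqP.
  by rewrite gtn_eqF.
apply: (@corank_overdetermined _ w); first by rewrite -(prednK (S_gt0 w)).
apply: lt_le_trans (hm w); rewrite eW ltz_nat; exact: leq_ltn_trans hw.
Qed.

End SingletonSets.

(* Replacing a generator g h by g, and by h in complementary degree, can only
   lower the corank by the corank of the second ideal. *)
Lemma corank_split m W j w b b' : w \in W j ->
  let W1 i := if i == j then [set w] else W i in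
  let W2 i := if i == j then W j :\ w else W i in
  corank_le m W1 b -> corank_le (fun v => m v - (v == w)%:Z) W2 b' ->
  corank_le m W (b + b').
Proof.
move=> wj W1 W2 [q hq] [q' hq'].
have g1 : gen W1 j = linf S (th j) w by rewrite /gen /W1 eqxx big_set1.
have g2 : linf S (th j) w * gen W2 j = gen W j.
  by rewrite /gen /W2 eqxx [RHS](big_setD1 w).
have gn1 i : i != j -> gen W1 i = gen W i by rewrite /gen /W1 => /negPf ->.
have gn2 i : i != j -> gen W2 i = gen W i by rewrite /gen /W2 => /negPf ->.
exists (fun i : 'I_(b + b') => match fintype.split i with inl i => q i
                 | inr i => linf S (th j) w * q' i end) => p hp.
have [a [h [hh ep]]] := hq p hp.
(* The cofactor of the linear form is reduced in turn modulo the second ideal, in a degree smaller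
   by one in group [w]. *)
have hj : mhomog (fun v => m v - (v == w)%:Z) (h j).
  by apply: eq_mhomog (hh j) => v; rewrite /W1 eqxx inE.
have [a' [h' [hh' ep']]] := hq' _ hj.
exists (fun i : 'I_(b + b') => match fintype.split i with inl i => a i | inr i => a' i end).
rewrite big_split_ord /=.
under eq_bigr do rewrite (unsplitK (inl _)).
under [X in _ - (_ + X)]eq_bigr do rewrite (unsplitK (inr _)) scalerAr.
rewrite -mulr_sumr opprD addrA ep (bigD1 j) //= g1 addrAC mulrC -mulrBr ep'.
apply: in_idealD; last first.
  apply: in_ideal_sum => i ij; rewrite gn1 //; apply: in_ideal_gen.
  by have := hh i; rewrite /W1 (negPf ij).
rewrite mulr_sumr; apply: in_ideal_sum => i _.
case: (eqVneq i j) => [->|ij].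
  rewrite mulrCA g2; apply: in_ideal_gen.
  apply: eq_mhomog (hh' j) => v; rewrite /W2 eqxx !inE.
  by case: eqP => [->|_]; rewrite ?wj /= ?subr0.
rewrite gn2 // mulrA; apply: in_ideal_gen.
apply: eq_mhomog (mhomogM (mhomog_linf S (th j) w) (hh' i)) => v.
by rewrite /W2 (negPf ij) addrA [_ + (m v - _)]addrC subrK.
Qed.

(** The two summands count the assignments with [c j = w] and those with [c j != w]. This is the
    recursion that [corank_split] gives for the corank. *)
Lemma card_assignments_split W j w : w \in W j ->
  let W1 i := if i == j then [set w] else W i in
  let W2 i := if i == j then W j :\ w else W i in
  #|assignments W| = (#|assignments W1| + #|assignments W2|)%N.
Proof.
move=> wj W1 W2.
rewrite -(cardsID [set c : {ffun J -> G} | c j == w] (assignments W)).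
congr (_ + _)%N; apply: eq_card => c; rewrite !inE.
  rewrite -andbA [X in _ && X]andbC andbA; congr (_ && _).
  apply/andP/forallP => [[/forallP h /eqP cj] i|h].
    by rewrite /W1; case: eqP => [->|_] //; rewrite inE cj.
  have := h j; rewrite /W1 eqxx inE => cj; split=> //; apply/forallP => i.
  by have := h i; rewrite /W1; case: eqP => [->|//]; rewrite inE => /eqP ->.
rewrite andbA; congr (_ && _).
apply/andP/forallP => [[cj /forallP h] i|h].
  by rewrite /W2; case: eqP => [->|_] //; rewrite !inE cj h.
have := h j; rewrite /W2 eqxx !inE => /andP [cj _]; split=> //; apply/forallP => i.
by have := h i; rewrite /W2; case: eqP => [->|//]; rewrite !inE => /andP [].
Qed.

(** Corank and number of assignments obey the same recursion, so induction on the total size of the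
    sets [W j] reduces to singletons. The condition on [m] keeps the degrees large enough in both
    branches. *)
Lemma corank_bound W m : (forall w, (#|[set j | w \in W j]|)%:Z <= m w) ->
  corank_le m W #|assignments W|.
Proof.
elim: {W}_.+1 {-2}W m (ltnSn (\sum_j #|W j|)%N) => // n IH W m; rewrite ltnS => le hm.
case: (boolP [forall j, #|W j| == 1%N]) => [/forallP h1|].
  have [c hc] : exists c : {ffun J -> G}, W =1 fun j => [set c j].
    have h j : exists w, W j == [set w] by have /cards1P [w ->] := h1 j; exists w.
    by exists [ffun j => xchoose (h j)] => j; rewrite ffunE; apply/eqP/(xchooseP (h j)).
  have -> : W = fun j => [set c j] by apply: funext.
  by apply: corank_set1 => w; apply: le_trans (hm w); under eq_finset do rewrite -hc.
rewrite negb_forall => /existsP [j Wj].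
have [W0|[w wj]] := set_0Vmem (W j).
  have -> : #|assignments W| = 0%N.
    apply/eqP; rewrite cards_eq0 -finset.subset0; apply/fintype.subsetP => c.
    by rewrite inE => /andP [/forallP /(_ j)]; rewrite W0 inE.
  exists (fun=> 0) => p hp; exists (fun=> 0); rewrite big_ord0 subr0.
  (* For an empty [W j] the generator is the empty product 1, and the ideal is everything. *)
  have -> : p = p * gen W j by rewrite /gen W0 big_set0 mulr1.
  by apply: in_ideal_gen; apply: eq_mhomog hp => v; rewrite W0 inE subr0.
have W2 : (1 < #|W j|)%N.
  by rewrite ltn_neqAle eq_sym Wj card_gt0; apply/set0Pn; exists w.
have := card_assignments_split wj; set W1 := fun i => _; set W2' := fun i => _ => ->.
have sub1 i : W1 i \subset W i by rewrite /W1; case: eqP => [->|_] //; rewrite finset.sub1set.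
have sub2 i : W2' i \subset W i by rewrite /W2'; case: eqP => [->|_] //; rewrite finset.subD1set.
have dec (U : J -> {set G}) : (forall i, U i \subset W i) -> (#|U j| < #|W j|)%N ->
    (\sum_i #|U i| < n)%N.
  move=> sU lt; apply: leq_trans le; rewrite (bigD1 j) //= [X in (_ < X)%N](bigD1 j) //=.
  by rewrite -addSn leq_add // leq_sum // => i _; apply: subset_leq_card.
apply: (corank_split wj); apply: IH.
- by apply: dec => //; rewrite /W1 eqxx cards1.
- move=> v; apply: le_trans (hm v); rewrite lez_nat subset_leq_card //.
  by apply/fintype.subsetP => i; rewrite !inE; apply: (fintype.subsetP (sub1 i)).
- by apply: dec => //; rewrite /W2' eqxx [X in (_ < X)%N](cardsD1 w) wj.
(* The degree at [w] drops by one, but so does the number of sets containing [w], since [w] has left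
   [W j]. *)
move=> v; case: (eqVneq v w) => [->|nvw]; last first.
  rewrite subr0; apply: le_trans (hm v); rewrite lez_nat subset_leq_card //.
  by apply/fintype.subsetP => i; rewrite !inE; apply: (fintype.subsetP (sub2 i)).
rewrite lerBrDr; apply: le_trans (hm w).
rewrite -PoszD lez_nat addn1 [X in (_ < X)%N](cardsD1 j) inE wj ltnS subset_leq_card //.
apply/fintype.subsetP => i; rewrite !inE /W2'; case: eqP => [->|_ ->] //.
by rewrite !inE eqxx.
Qed.

End CorankBound.

(** * Expansion of products and rank estimates *)

Lemma bigA_distr_dffun (R : comPzSemiRingType) (I : finType) (T : I -> finType)
    (F : forall i, T i -> R) :
  \prod_i \sum_(a : T i) F i a =
  \sum_(s : {dffun forall i, T i}) \prod_i F i (s i).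
Proof.
rewrite (reindex (@dffun_of_fprod _ T)); last exact/onW_bij/dffun_of_fprod_bij.
transitivity (\sum_(t : fprod T) \prod_i [ffun a => F i a] (t i)); last first.
  by apply: eq_bigr => t _; apply: eq_bigr => i _; rewrite !ffunE.
rewrite (big_fprod (T_ := T) 1 (+%R : Monoid.add_law 0 *%R) (fun i => [ffun a => F i a])).
rewrite -(bigA_distr_big_dep (fun i => mem (tagged_with T i)) (fun i => untag 0 [ffun a => F i a])); apply: eq_bigr => i _.
rewrite (big_tag (fun i => F i)); apply: eq_bigr => j _.
congr (untag _ _ j); apply: funext => a; by rewrite ffunE.
Qed.

Lemma sum_enum_val (V : nmodType) (I : finType) (F : I -> V) :
  \sum_i F i = \sum_(k < #|I|) F (enum_val k).
Proof. by rewrite (reindex _ (onW_bij _ (@enum_val_bij I))). Qed.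

Section RankBound.
Context {F : fieldType}.

(** The rows of [A] and [Q] together span the whole space and [A] kills [E], so [E] factors through
    [Q *m E], which has only [b] rows. *)
Lemma row_full_annihilated_rank (r b c n : nat) (A : 'M[F]_(r, c))
    (Q : 'M[F]_(b, c)) (E : 'M[F]_(c, n)) (L : 'M[F]_(n, c)) :
  row_full (col_mx A Q) -> A *m E = 0 -> \rank (L *m E) = n -> (n <= b)%N.
Proof.
move=> /row_fullP [K hK] AE rk.
have : E = rsubmx K *m (Q *m E).
  rewrite -[LHS]mul1mx -hK -[in LHS](hsubmxK K) mul_row_col mulmxDl -!mulmxA AE.
  by rewrite mulmx0 add0r.
move=> eE; rewrite -rk; apply: leq_trans (mxrankM_maxr _ _) _.
rewrite eE; apply: leq_trans (mxrankM_maxr _ _) _.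
by apply: leq_trans (mxrankM_maxl _ _) _; apply: rank_leq_row.
Qed.

(* Full rank is an open condition: P is the determinant of the product with a
   fixed left inverse at x0. *)
Lemma row_full_generic (K r b c : nat) (A : 'M[{mpoly F[K]}]_(r, c))
    (Q : 'M[F]_(b, c)) (x0 : 'I_K -> F) :
  row_full (col_mx (map_mx (meval x0) A) Q) ->
  exists2 P : {mpoly F[K]}, P.@[x0] != 0 &
    forall x, P.@[x] != 0 -> row_full (col_mx (map_mx (meval x) A) Q).
Proof.
move=> /row_fullP [L hL].
pose C x := col_mx (map_mx (meval x) A) Q.
pose P := \det (map_mx (@mpolyC K F) L *m col_mx A (map_mx (@mpolyC K F) Q)).
have hP x : P.@[x] = \det (L *m C x).
  have mC (m n : nat) (M : 'M[F]_(m, n)) : map_mx (meval x) (map_mx (@mpolyC K F) M) = M.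
    by apply/matrixP => i j; rewrite !mxE mevalC.
  by rewrite /P -det_map_mx map_mxM map_col_mx !mC.
exists P; first by rewrite hP hL det1 oner_neq0.
move=> x; rewrite hP -unitfE -unitmxE => u.
by apply/row_fullP; exists (invmx (L *m C x) *m L); rewrite -mulmxA mulVmx.
Qed.

End RankBound.

(** * Bounding the solutions of generic multilinear systems *)

Section GenericSolutionBound.
Context {R : numFieldType} {G : finType} (S : G -> finType) {J : finType}.
Context (th : J -> R) (W : J -> {set G}).
Local Notation nV := #|{: {w : G & S w}}|.
Local Notation poly := {mpoly R[nV]}.

Definition prof (X : {set G}) : finType :=
  {dffun forall w : {w | w \in X}, S (val w)}.

Definition mono_prof (X : {set G}) (s : prof X) : poly := \prod_w @pvar R G S (val w) (s w).

Definition mlform (X : {set G}) (a : prof X -> R) : poly :=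
  \sum_s a s *: mono_prof s.

Definition point := forall w : G, S w -> R.

Definition flat (pt : point) (i : 'I_nV) : R :=
  pt (tag (enum_val i)) (tagged (enum_val i)).

Lemma flat_pvar (pt : point) w (a : S w) : (pvar a : poly).@[flat pt] = pt w a.
Proof. by rewrite /pvar mevalXU /flat enum_rankK. Qed.

Lemma flat_mlform (pt : point) (X : {set G}) (a : prof X -> R) :
  (mlform a).@[flat pt] = \sum_s a s * \prod_w pt (val w) (s w).
Proof.
rewrite /mlform rmorph_sum /=; apply: eq_bigr => s _.
rewrite mevalZ rmorph_prod /=; congr (_ * _); apply: eq_bigr => w _.
exact: flat_pvar.
Qed.

Lemma mhomog_mono_prof (X : {set G}) (s : prof X) :
  mhomog (fun w => (w \in X)%:Z) (mono_prof s).
Proof.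
have h := @mhomog_prod R G S _ predT _ _ (fun w _ => @mhomog_var R G S (val w) (s w)).
apply: eq_mhomog h => w /=.
case: (boolP (w \in X)) => [wX|nwX].
  rewrite (bigD1 (exist _ w wX)) //= eqxx big1 ?addr0 // => v nv.
  by case: eqP => // e; rewrite -val_eqE /= -e eqxx in nv.
by rewrite big1 // => v _; case: eqP => // e; rewrite e (valP v) in nwX.
Qed.

Lemma mhomog_mlform (X : {set G}) (a : prof X -> R) :
  mhomog (fun w => (w \in X)%:Z) (mlform a).
Proof.
by apply: mhomog_sum => s _; apply: mhomogZ; apply: mhomog_mono_prof.
Qed.

(** Expanding the product exhibits [gen] as a multilinear form with special coefficients; these
    become the base point [x0] of the genericity argument. *)
Lemma gen_mlform j :
  gen S th W j = mlform (fun s : prof (W j) => \prod_w th j ^+ enum_rank (s w)).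
Proof.
rewrite /gen (big_sub (mem (W j))) /=.
rewrite /linf bigA_distr_dffun; apply: eq_bigr => s _.
rewrite /mono_prof -mul_mpolyC rmorph_prod -big_split; apply: eq_bigr => w _ /=.
by rewrite mul_mpolyC.
Qed.

Lemma mdeg_gdeg (mu : 'X_{1..nV}) : mdeg mu = (\sum_w @gdeg G S w mu)%N.
Proof.
rewrite mdegE (reindex (@enum_rank {: {w : G & S w}})) /=; last first.
  by apply: onW_bij; exists enum_val; [apply: enum_rankK | apply: enum_valK].
by rewrite sig_big_dep /=; apply: eq_bigr => -[w a] _.
Qed.

(** * The Macaulay matrix in a fixed multidegree *)

Section Macaulay.
Context (m : nat).
(** A strict bound on the total degree of the monomials of degree at most [m] in every group, which
    makes the index types finite. *)
Let b := (#|G| * m).+1.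
Let of_deg (mu : 'X_{1..nV}) := [forall w, @gdeg G S w mu == m].

(* Rows are the multiples of the equations by monomials of complementary
   degree, columns the monomials of degree m in every group. *)
Definition macaulay_col : finType := {mu : 'X_{1..nV < b} | of_deg mu}.
Definition macaulay_row : finType := (J * 'X_{1..nV < b})%type.

Lemma macaulay_bounded mu : (forall w, @gdeg G S w mu <= m)%N -> (mdeg mu < b)%N.
Proof.
by move=> h; rewrite mdeg_gdeg ltnS -sum_nat_const; apply: leq_sum => w _.
Qed.

Lemma mhomog_expand (p : poly) : mhomog (fun=> m%:Z) p ->
  p = \sum_(c : macaulay_col) p@_(val (val c)) *: 'X_[val (val c)].
Proof.
move=> /mhomogP hp.
have hs : (msize p <= b)%N.
  rewrite msizeE; apply/bigmax_leqP_seq => mu hmu _.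
  by apply: macaulay_bounded => w; rewrite -lez_nat hp.
rewrite {1}(mpolywE hs) (bigID (fun mu : 'X_{1..nV < b} => of_deg mu)) /=.
rewrite [X in _ + X]big1 ?addr0 => [|mu]; last first.
  rewrite negb_forall => /existsP [w hw]; rewrite memN_msupp_eq0 ?scale0r //.
  by apply: contra hw => /hp /(_ w) [->].
exact: (big_sub (fun mu : 'X_{1..nV < b} => of_deg mu) (fun mu => p@_mu *: 'X_[mu])).
Qed.

Definition row_ok (r : macaulay_row) : bool :=
  [forall w, (@gdeg G S w r.2)%:Z == m%:Z - (w \in W r.1)%:Z].

Definition macaulay_poly (a : forall j, prof (W j) -> R) (r : macaulay_row) : poly :=
  if row_ok r then 'X_[r.2] * mlform (a r.1) else 0.

Lemma mhomog_macaulay_poly a r : mhomog (fun=> m%:Z) (macaulay_poly a r).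
Proof.
rewrite /macaulay_poly; case: ifP => [/forallP ok|_]; last exact: mhomog0.
have hX : mhomog (fun w => m%:Z - (w \in W r.1)%:Z) ('X_[r.2] : poly).
  by apply/mhomogP => mu; rewrite msuppX inE => /eqP -> w; apply/eqP.
by apply: eq_mhomog (mhomogM hX (mhomog_mlform (a r.1))) => w; rewrite subrK.
Qed.

Definition macaulay_mx (a : forall j, prof (W j) -> R) :
    'M[R]_(#|macaulay_row|, #|macaulay_col|) :=
  \matrix_(r, c) (macaulay_poly a (enum_val r))@_(val (val (enum_val c))).

(** Expanding the cofactors into monomials shows that the ideal in this degree lies in the span of
    the row polynomials. *)
Lemma in_ideal_macaulay (p : poly) : in_ideal th (fun=> m%:Z) W p ->
  exists u : macaulay_row -> R, p = \sum_r u r *: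
    macaulay_poly (fun j s => \prod_w th j ^+ enum_rank (s w)) r.
Proof.
move=> [h [hh ->]]; exists (fun r : macaulay_row => (h r.1)@_(val r.2)).
rewrite -(pair_bigA _ (fun j (mu : 'X_{1..nV < b}) => (h j)@_(val mu) *: macaulay_poly _ (j, mu))) /=.
apply: eq_bigr => j _; have /mhomogP hj := hh j.
have hs : (msize (h j) <= b)%N.
  rewrite msizeE; apply/bigmax_leqP_seq => mu hmu _.
  apply: macaulay_bounded => w; rewrite -lez_nat hj //.
  by rewrite lerBlDr -PoszD lez_nat leq_addr.
rewrite {1}(mpolywE hs) mulr_suml; apply: eq_bigr => mu _.
rewrite /macaulay_poly; case: ifP => [_|/negbT].
  by rewrite gen_mlform scalerAl.
rewrite negb_forall => /existsP [w hw]; rewrite memN_msupp_eq0 ?scale0r ?mul0r //.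
by apply: contra hw => /hj /(_ w) /= ->.
Qed.

(** Each monomial of degree [m] is a combination of row polynomials and of the [qs i], so each unit
    row vector lies in the row space. *)
Lemma macaulay_corank (q : nat) :
  corank_le S th (fun=> m%:Z) W q ->
  exists Q : 'M[R]_(q, #|macaulay_col|),
    row_full (col_mx (macaulay_mx (fun j s => \prod_w th j ^+ enum_rank (s w))) Q).
Proof.
move=> [qs hq]; pose Q := \matrix_(i < q, c < #|macaulay_col|)
  (qs i)@_(val (val (enum_val c))).
exists Q; rewrite -sub1mx; apply/row_subP => c.
have hc : mhomog (fun=> m%:Z) ('X_[val (val (enum_val c))] : poly).
  apply/mhomogP => mu; rewrite msuppX inE => /eqP -> w; congr Posz.
  by apply/eqP; apply: (forallP (valP (enum_val c))).
have [a /in_ideal_macaulay [u hu]] := hq _ hc.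
apply/submxP; exists (row_mx (\row_r u (enum_val r)) (\row_i a i)).
rewrite mul_row_col; apply/matrixP => i d; rewrite !mxE.
transitivity (('X_[val (val (enum_val c))] : poly)@_(val (val (enum_val d)))).
  by rewrite mcoeffX !val_eqE (inj_eq enum_val_inj).
move/eqP: hu; rewrite subr_eq => /eqP ->.
rewrite mcoeffD !raddf_sum /=; congr (_ + _).
  rewrite sum_enum_val /=.
  by apply: eq_bigr => r _; rewrite mcoeffZ !mxE.
by apply: eq_bigr => k _; rewrite mcoeffZ !mxE.
Qed.

(** A row times the vector of monomial values is the value of its polynomial at [pt], and that
    polynomial is 0 or a multiple of an equation. *)
Lemma macaulay_root a (pt : point) :
  (forall j, (mlform (a j)).@[flat pt] = 0) ->
  macaulay_mx a *m (\col_c 'X_[val (val (enum_val c))].@[flat pt]) = 0.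
Proof.
move=> h; apply/matrixP => r i; rewrite !mxE.
transitivity (macaulay_poly a (enum_val r)).@[flat pt]; last first.
  by rewrite /macaulay_poly; case: ifP; rewrite ?meval0 // mevalM h mulr0.
rewrite [in RHS](mhomog_expand (mhomog_macaulay_poly a _)) rmorph_sum /=.
rewrite [RHS]sum_enum_val /=.
by apply: eq_bigr => c _; rewrite mevalZ !mxE.
Qed.

End Macaulay.

(** For each other point, a linear form of one group vanishes there but not at [pt i]; the product
    of these forms separates [pt i]. Multiplying by the coordinate sums [sg w], which are 1 at all
    points, adjusts degrees without changing values. *)
Lemma separate_points (m n : nat) (pt : 'I_n -> point) (i : 'I_n) :
  (n <= m.+1)%N -> (forall k w, \sum_a pt k w a = 1) ->
  (forall k l, k != l -> exists w a, pt k w a != pt l w a) ->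
  exists2 p : poly, mhomog (fun=> m%:Z) p &
    forall k, (p.@[flat (pt k)] != 0) = (k == i).
Proof.
move=> nm s1 dist; pose sg w : poly := \sum_(a : S w) pvar a.
have hsg w : mhomog (fun v => (v == w)%:Z) (sg w).
  by apply: mhomog_sum => a _; apply: mhomog_var.
have esg k w : (sg w).@[flat (pt k)] = 1.
  by rewrite rmorph_sum -[RHS](s1 k w); apply: eq_bigr => a _; apply: flat_pvar.
have deg1 w p : mhomog (fun v => (v == w)%:Z) p ->
    mhomog (fun=> 1) (p * \prod_(v | v != w) sg v).
  move=> hp; apply: eq_mhomog (mhomogM hp (mhomog_prod (fun v _ => hsg v))) => v /=.
  case: (eqVneq v w) => [->|nvw].
    by rewrite big1 // => u; rewrite eq_sym => /negPf ->.
  by rewrite (bigD1 v) //= eqxx big1 // => u /andP [_]; rewrite eq_sym => /negPf ->.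
have [g hg] : exists g : 'I_n -> poly, forall k, k != i ->
    [/\ mhomog (fun=> 1) (g k), (g k).@[flat (pt k)] = 0 & (g k).@[flat (pt i)] != 0].
  apply: (@fin_all_exists _ (fun=> poly)
    (fun k g => k != i -> [/\ mhomog (fun=> 1) g, g.@[flat (pt k)] = 0 & g.@[flat (pt i)] != 0])) => k.
  case: (eqVneq k i) => [_|ki]; first by exists 0.
  have [w [a ne]] := dist _ _ ki.
  have ev l : ((pvar a - pt k w a *: sg w) * \prod_(v | v != w) sg v).@[flat (pt l)] =
      pt l w a - pt k w a.
    rewrite mevalM mevalB mevalZ esg mulr1 flat_pvar rmorph_prod big1 ?mulr1 // => v _.
    exact: esg.
  exists ((pvar a - pt k w a *: sg w) * \prod_(v | v != w) sg v) => _; split.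
  - apply: deg1; rewrite -scaleNr; apply: mhomogD; first exact: mhomog_var.
    by apply: mhomogZ.
  - by rewrite ev subrr.
  - by rewrite ev subr_eq0 eq_sym.
pose t := \prod_w sg w.
have ht : mhomog (fun=> 1) t.
  apply: eq_mhomog (mhomog_prod (fun v _ => hsg v)) => v /=.
  by rewrite (bigD1 v) //= eqxx big1 // => u; rewrite eq_sym => /negPf ->.
have et k : t.@[flat (pt k)] = 1.
  by rewrite rmorph_prod big1 // => w _; apply: esg.
clearbody t.
(* There are [n.-1] separating factors of degree 1 in every group; the copies of [t] fill up the
   degree to [m]. *)
exists (\prod_(k | k != i) g k * \prod_(l < m - n.-1) t).
  apply: eq_mhomog (mhomogM (mhomog_prod (m := fun _ _ => 1) _)
    (mhomog_prod (m := fun _ _ => 1) _)) => [w|k|l _] //=; last by case/hg.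
  rewrite !sumr_const card_ord (_ : #|_| = n.-1); last first.
    by rewrite -[in RHS](card_ord n) -(cardC1 i); apply: eq_card => k.
  by rewrite -mulrnDr subnKC ?natz //; case: (n) nm.
move=> k; rewrite mevalM !rmorph_prod /= mulf_eq0 negb_or.
rewrite [X in _ && X](_ : _ = true) ?andbT; last first.
  by rewrite big1 ?oner_neq0 // => l _; apply: et.
case: (eqVneq k i) => [->|ki].
  by apply/prodf_neq0 => l /hg [].
by apply/negbTE; rewrite negbK (bigD1 k) //=; case: (hg k ki) => _ -> _; rewrite mul0r.
Qed.

Theorem generic_solution_bound (K : nat)
    (cf : forall j, prof (W j) -> {mpoly R[K]}) (x0 : 'I_K -> R) :
  injective th -> (forall j, th j != 0) -> (forall w, (0 < #|S w|)%N) ->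
  #|J| = (\sum_w #|S w|.-1)%N ->
  (forall j s, (cf j s).@[x0] = \prod_w th j ^+ enum_rank (s w)) ->
  exists2 P : {mpoly R[K]}, P.@[x0] != 0 &
    forall x, P.@[x] != 0 -> forall n (pt : 'I_n -> point),
      (forall k w, \sum_a pt k w a = 1) ->
      (forall k l, k != l -> exists w a, pt k w a != pt l w a) ->
      (forall k j, \sum_s (cf j s).@[x] * \prod_w pt k (val w) (s w) = 0) ->
      (n <= #|assignments S W|)%N.
Proof.
(* The summand [#|J|] meets the degree condition of [corank_bound], and [B] allows [B.+1] points to
   be separated. *)
move=> thI th0 S0 cJ cf0; set B := #|assignments S W|; pose m := (#|J| + B)%N.
have [Q hQ] : exists Q : 'M[R]_(B, #|macaulay_col m|),
    row_full (col_mx (macaulay_mx m (fun j s => \prod_w th j ^+ enum_rank (s w))) Q).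
  apply: macaulay_corank; apply: corank_bound => // w.
  by rewrite lez_nat; apply: leq_trans (max_card _) (leq_addr _ _).
(* The Macaulay matrix with polynomial entries in the data; at [x0] it becomes that of the product
   system. *)
pose M := \matrix_(r < #|macaulay_row m|, c < #|macaulay_col m|)
  (if row_ok (enum_val r) then \sum_s cf (enum_val r).1 s *
     (('X_[(enum_val r).2] * mono_prof s)@_(val (val (enum_val c))))%:MP else 0).
have hM x : map_mx (meval x) M = macaulay_mx m (fun j s => (cf j s).@[x]).
  apply/matrixP => r c; rewrite !mxE /macaulay_poly; case: ifP => _; last first.
    by rewrite meval0 mcoeff0.
  rewrite rmorph_sum /mlform mulr_sumr raddf_sum /=; apply: eq_bigr => s _.
  by rewrite mevalM mevalC -scalerAr mcoeffZ.
have [|P P0 hP] := @row_full_generic _ _ _ _ _ M Q x0.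
  rewrite hM; move: hQ; congr (is_true (row_full (col_mx _ _))).
  by congr macaulay_mx; apply: functional_extensionality_dep => j; apply: funext => s; rewrite cf0.
exists P => // x /hP; rewrite hM => full n pt s1 dist root.
rewrite leqNgt; apply/negP => lt.
pose pt' (i : 'I_B.+1) := pt (widen_ord lt i).
pose E := \matrix_(c < #|macaulay_col m|, i < B.+1)
  'X_[val (val (enum_val c))].@[flat (pt' i)].
have ME : macaulay_mx m (fun j s => (cf j s).@[x]) *m E = 0.
  apply/matrixP => r i.
  transitivity ((macaulay_mx m (fun j s => (cf j s).@[x]) *m
      \col_c 'X_[val (val (enum_val c))].@[flat (pt' i)]) r 0).
    by rewrite !mxE; apply: eq_bigr => c _; rewrite !mxE.
  by rewrite macaulay_root ?mxE // => j; rewrite flat_mlform root.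
have sep i : exists p : poly, mhomog (fun=> m%:Z) p /\
    forall k, (p.@[flat (pt' k)] != 0) = (k == i).
  have [|||p] := @separate_points m B.+1 pt' i; first by rewrite ltnS leq_addl.
  - by move=> k w; apply: s1.
  - by move=> k l kl; apply: dist.
  by exists p.
have [p hp] := fin_all_exists sep.
(* The rows of [L] are the separating polynomials, so [L *m E] is diagonal with nonzero entries and
   the [B.+1] evaluations are independent. *)
pose L := \matrix_(i < B.+1, c < #|macaulay_col m|) (p i)@_(val (val (enum_val c))).
have LE : L *m E = diag_mx (\row_i (p i).@[flat (pt' i)]).
  apply/matrixP => i k; rewrite !mxE.
  transitivity (p i).@[flat (pt' k)].
    have [h _] := hp i; rewrite [in RHS](mhomog_expand h) rmorph_sum /=.
    rewrite [RHS]sum_enum_val /=.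
    by apply: eq_bigr => c _; rewrite mevalZ !mxE.
  have [_ /(_ k)] := hp i; case: (eqVneq i k) => [->|ik]; first by rewrite mulr1n.
  by move=> /negbFE/eqP ->; rewrite mulr0n.
have /= := row_full_annihilated_rank full ME (L := L); rewrite LE ltnn => h.
suff /h : \rank (diag_mx (\row_i (p i).@[flat (pt' i)])) = B.+1 by [].
apply: mxrank_unit; rewrite unitmxE det_diag unitfE; apply/prodf_neq0 => i _.
by have [_ e] := hp i; rewrite mxE e eqxx.
Qed.

End GenericSolutionBound.

(** * Comparing assignments with the permanent *)

Section Permanent.
Context {G : finType} (d : G -> nat).
Local Notation J := {v : G & 'I_(d v)}.
Implicit Types (c : {ffun J -> G}) (q : {dffun forall v, 'S_(d v)}).

Definition fibres_ok c := forall w, #|[set j | c j == w]| = d w.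

(** Each [j] is numbered by its position in its own fibre, so [j] is recovered from [c j] and its
    number. *)
Lemma fibre_enum c : fibres_ok c -> exists f : forall j, 'I_(d (c j)),
  injective (fun j => Tagged (fun v => 'I_(d v)) (f j)).
Proof.
move=> hc; pose E w := enum [set j | c j == w].
have lt j : (index j (E (c j)) < d (c j))%N.
  by rewrite -hc cardE index_mem mem_enum inE.
exists (fun j => Ordinal (lt j)) => j k e.
have eck : c j = c k := congr1 tag e.
have : index j (E (c j)) = index k (E (c k)).
  have := congr1 (fun u : J => val (tagged u)) e; by [].
rewrite eck => /(congr1 (nth j (E (c k)))).
by rewrite !nth_index // mem_enum inE ?eck.
Qed.

(** The numbering of the fibres identifies [J] with itself over [c]; composing it with any
    permutation inside each block gives another permutation inducing [c]. *)
Lemma fibre_perm c : fibres_ok c ->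
  exists f : {dffun forall v, 'S_(d v)} -> {perm J},
    (forall q j, tag (f q j) = c j) /\ injective f.
Proof.
move=> hc; have [f fI] := fibre_enum hc.
pose F (q : {dffun forall v, 'S_(d v)}) j := Tagged (fun v => 'I_(d v)) (q (c j) (f j)).
have FI q : injective (F q).
  move=> j k e; apply: fI; have eck : c j = c k := congr1 tag e.
  move: e; rewrite /F; move: (f j) (f k); rewrite eck => x y /eqP.
  by rewrite eq_Tagged /= => /eqP /perm_inj ->.
exists (fun q => perm (@FI q)); split=> [q j|q q' e]; first by rewrite permE.
apply/ffunP => v; apply/permP => x.
have [g gK Kg] := injF_bij fI.
pose u : J := Tagged (fun v => 'I_(d v)) x.
have /permP /(_ (g u)) := e; rewrite !permE /F.
have := Kg u; rewrite /u; move: (g _) => j ej.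
have ev : c j = v := congr1 tag ej.
move: ej; case: v / ev x @u => x _ /eqP; rewrite eq_Tagged /= => /eqP <- /eqP.
by rewrite eq_Tagged /= => /eqP.
Qed.

Lemma card_block_perms :
  #|{: {dffun forall v, 'S_(d v)}}| = (\prod_v (d v)`!)%N.
Proof.
rewrite -(bij_eq_card (dffun_of_fprod_bij (fun v => {perm 'I_(d v)}))) card_fprod.
by apply: eq_bigr => v _; apply: card_Sn.
Qed.

Lemma card_le_sum_perm (R : numFieldType) (g : G -> R) (F : {perm J} -> R)
    (C : {set {ffun J -> G}}) :
  (forall c, c \in C -> fibres_ok c) ->
  (forall w, g w ^+ d w = (d w)`!%:R^-1) ->
  (forall p, 0 <= F p) ->
  (forall (p : {perm J}) c, c \in C -> (forall j, tag (p j) = c j) -> F p = \prod_j g (c j)) ->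
  #|C|%:R <= \sum_p F p.
Proof.
move=> hC hg F0 hF.
have [f hf] : exists f : {ffun J -> G} -> {dffun forall v, 'S_(d v)} -> {perm J},
    forall c, c \in C -> (forall q j, tag (f c q j) = c j) /\ injective (f c).
  apply: (@fin_all_exists _ (fun=> {dffun forall v, 'S_(d v)} -> {perm J})
    (fun c f => c \in C -> (forall q j, tag (f q j) = c j) /\ injective f)) => c.
  case: (boolP (c \in C)) => [/hC /fibre_perm [f hf]|_]; first by exists f.
  by exists (fun=> 1%g).
pose D := finset.setX C [set: {dffun forall v, 'S_(d v)}].
pose f' u := f u.1 u.2.
have fI : {in D &, injective f'}.
  move=> [c q] [c' q']; rewrite !inE !andbT /f' /= => hc hc' e.
  have ec : c = c'.
    apply/ffunP => j; have [h _] := hf _ hc; have [h' _] := hf _ hc'.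
    by rewrite -(h q) -(h' q') e.
  by rewrite -ec in e *; have [_ /(_ _ _ e) ->] := hf _ hc.
apply: (@le_trans _ _ (\sum_(p in f' @: D) F p)); last first.
  by rewrite [leRHS](bigID (mem (f' @: D))) /= lerDl sumr_ge0.
rewrite big_imset //=.
have Fv u : u \in D -> F (f' u) = (\prod_w (d w)`!%:R)^-1.
  case: u => c q; rewrite !inE andbT /f' /= => hc; have [h _] := hf _ hc.
  rewrite (hF _ c) // (partition_big c predT) //= -prodfV; apply: eq_bigr => w _.
  rewrite -hg -(hC _ hc w) -prodr_const; apply: eq_big => [j|j /eqP -> //].
  by rewrite inE.
rewrite (eq_bigr _ Fv) sumr_const cardsX cardsT card_block_perms -natr_prod.
rewrite mulrnA mulrnAC -[_^-1 *+ _]mulr_natr mulVf //.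
by rewrite pnatr_eq0 -lt0n prodn_gt0 // => w; apply: fact_gt0.
Qed.

End Permanent.

Lemma permanent_enum (R : comNzRingType) (I : finType) (F : I -> I -> R) :
  permanent (\matrix_(a < #|I|, b < #|I|) F (enum_val a) (enum_val b)) =
  \sum_(p : {perm I}) \prod_i F i (p i).
Proof.
have fI (p : {perm I}) : injective (fun a : 'I_#|I| => enum_rank (p (enum_val a))).
  by move=> a b /enum_rank_inj /perm_inj /enum_val_inj.
have gI (s : 'S_#|I|) : injective (fun i : I => enum_val (s (enum_rank i))).
  by move=> i j /enum_val_inj /perm_inj /enum_rank_inj.
rewrite /permanent (reindex (fun p : {perm I} => perm (@fI p))) /=; last first.
  exists (fun s => perm (@gI s)) => [p|s] _; apply/permP => i.
    by rewrite !permE enum_rankK enum_rankK.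
  by rewrite !permE enum_valK enum_valK.
apply: eq_bigr => p _.
rewrite [RHS](reindex _ (onW_bij _ (@enum_val_bij I))).
by apply: eq_bigr => a _; rewrite mxE permE enum_rankK.
Qed.

(** A permutation that sends every row of [v] to a column of a sibling of [v] runs along edges of
    the graph, so its term is the product of the weights; all other terms are nonnegative. *)
Lemma assignments_le_permanent (R : realType) (N : nat) (T : tree N)
    (A : 'I_N -> finType) (B : emergent T -> finType) :
  #|assignments (strat A B) (fun a : eqn_index A B => siblings (tag a))|%:R
    <= permanent (bernstein_mx A B R).
Proof.
pose g w : R := 1 / ((Defs.dim A B w)`!%:R `^ (Defs.dim A B w)%:R^-1).
rewrite /bernstein_mx permanent_enum.
apply: (card_le_sum_perm (g := g)) => [c|w|p|p c].
- by rewrite inE => /andP [_ /forallP h] w; apply/eqP/h.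
- rewrite /g div1r exprVn; congr (_^-1).
  have [->|d0] := posnP (Defs.dim A B w); first by rewrite expr0.
  rewrite -powR_mulrn ?powR_ge0 // -powRrM mulVf ?powRr1 ?ler0n //.
  by rewrite pnatr_eq0 -lt0n.
- apply: prodr_ge0 => j _; rewrite /bernstein_entry; case: ifP => // _.
  by rewrite div1r invr_ge0 powR_ge0.
rewrite inE => /andP [/forallP h _] e; apply: eq_bigr => j _.
by rewrite /bernstein_entry /edge e h.
Qed.

(** * Order structure of the tree *)

Section TreeOrder.
Context {N : nat} {T : tree N}.
Implicit Types (v w : node T) (e f : emergent T).

Lemma anc_inv v e : anc v e ->
  exists2 f, parent v = Some f & f = e \/ anc (inr f) e.
Proof.
rewrite /anc; case: (parent v) => [f|//] h; exists f => //.
case/connectP: h => -[|g p] /=; first by move=> _ ->; left.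
case/andP => /eqP -> hp ->; right; apply/connectP; by exists p.
Qed.

Lemma anc_cycle e f : anc (inr e) f -> anc (inr f) e -> False.
Proof. by move=> h /(anc_trans h); apply/negP/anc_irr. Qed.

Lemma child_ind (P : node T -> Prop) :
  (forall i, P (inl i)) ->
  (forall e, (forall w, parent w = Some e -> P w) -> P (inr e)) ->
  forall w, P w.
Proof.
move=> Pl Pe [i //|e].
have [n] := ubnP #|[set f | anc (inr f) e]|; elim: n e => // n IH e le.
apply: Pe => -[i|f] fe //; apply: IH.
rewrite ltnS in le; apply: leq_trans le; apply: proper_card.
apply/fintype.properP; split.
  by apply/fintype.subsetP => g; rewrite !inE => /anc_trans; apply; apply: anc_parent.
by exists f; rewrite !inE ?anc_irr // anc_parent.
Qed.

Lemma anc_ind (P : node T -> Prop) :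
  (forall v, (forall e, anc v e -> P (inr e)) -> P v) -> forall v, P v.
Proof.
move=> h v; have [n] := ubnP #|[set f | anc v f]|; elim: n v => // n IH v le.
apply: h => e ve; apply: IH; rewrite ltnS in le; apply: leq_trans le.
apply: proper_card; apply/fintype.properP; split.
  by apply/fintype.subsetP => f; rewrite !inE; apply: anc_trans.
by exists e; rewrite !inE ?anc_irr.
Qed.

Lemma anc_comparable v e f : anc v e -> anc v f ->
  [\/ e = f, anc (inr e) f | anc (inr f) e].
Proof.
elim/anc_ind: v => v IH ve vf.
have [g vg ge] := anc_inv ve; have [g' vg' gf] := anc_inv vf.
move: vg'; rewrite vg => -[e']; rewrite -{g'}e' in gf.
case: ge gf => [<-|ge] [<-|gf]; [by constructor 1|by constructor 2|by constructor 3|].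
exact: IH (anc_parent vg) ge gf.
Qed.

(** These are [e], its ancestors and the siblings of all of these: the nodes whose strategies enter
    the utility of [e]. *)
Definition above e w := parent w = None \/ exists2 f, parent w = Some f & anc (inr e) f.

Lemma above_not_desc e w f : above e w -> w = inr f -> ~~ anc (inr f) e.
Proof.
move=> + ew; rewrite ew => ab; apply/negP => /anc_inv [g fg ge].
case: ab => [|[h]]; rewrite fg // => -[<-] eg.
by case: ge eg => [->|ge eg]; [apply/negP/anc_irr | apply: (anc_cycle eg ge)].
Qed.

Lemma above_neq v e w : anc v e -> above e w -> w <> v.
Proof.
move=> /anc_inv [g vg ge] ab ewv; rewrite {}ewv in ab.
case: ab => [|[h]]; rewrite vg // => -[<-] eg.
by case: ge eg => [->|ge eg]; [apply/negP/anc_irr | apply: (anc_cycle eg ge)].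
Qed.

Lemma sibling_not_anc v w f : w \in siblings v -> w = inr f -> ~~ anc v f.
Proof.
rewrite inE => /andP [_ /eqP pw] ew; rewrite {}ew in pw; apply/negP => /anc_inv [g vg gf].
have fg : anc (inr f) g by apply: anc_parent; rewrite pw.
by case: gf fg => [->|gf fg]; [apply/negP/anc_irr | apply: (anc_cycle gf fg)].
Qed.

End TreeOrder.

(** * Deviations and indifference *)

Section Deviations.
Context {R : realType} {N : nat} {T : tree N}.
Context {A : 'I_N -> finType} {B : emergent T -> finType}.
Local Notation S := (strat A B).
Context (D : ent R A B) (sg : profile R A).
Arguments sg : clear implicits.
Hypothesis D_valid : ent_valid D.
Hypothesis sg_mixed : is_mixed sg.
Implicit Types (v w : node T) (e f : emergent T).

(** Extends [deviation] to players, so that all nodes can be treated alike. *)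
Definition node_deviation v (t : S v -> R) : node_profile :=
  eval D (dfwith (pin_players sg) (Some t)).
Arguments node_deviation [v] t _ _.

Local Notation x := (induced D sg : forall v : node T, S v -> R).

Lemma induced_inl i k : x (inl i) k = sg i k.
Proof. by rewrite /induced evalE. Qed.

Lemma induced_inr e k : x (inr e) k = emerge D x k.
Proof. by rewrite /induced evalE. Qed.

Lemma node_deviation_same v t : node_deviation t v = t.
Proof. by apply: funext => k; rewrite /node_deviation evalE dfwith_in. Qed.

Lemma node_deviation_inl v (t : S v -> R) i k : inl i <> v ->
  node_deviation t (inl i) k = sg i k.
Proof. by move=> nv; rewrite /node_deviation evalE dfwith_out //; apply/eqP => /esym. Qed.

Lemma node_deviation_inr v (t : S v -> R) e k : inr e <> v ->
  node_deviation t (inr e) k = emerge D (node_deviation t) k.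
Proof. by move=> nv; rewrite /node_deviation evalE dfwith_out //; apply/eqP => /esym. Qed.

Lemma node_deviation_out v (t : S v -> R) w : w <> v ->
  (forall f, w = inr f -> ~~ anc v f) -> node_deviation t w = x w.
Proof.
move: w; apply: (@child_ind N T) => [i|e IH] ne na; apply: funext => k.
  by rewrite node_deviation_inl // induced_inl.
rewrite node_deviation_inr // induced_inr; apply: eq_bigr => s _; congr (_ * _).
apply: eq_bigr => -[w wP] _ /=; have we : parent w = Some e.
  by move: (wP); rewrite inE => /eqP.
rewrite IH // => [ewv|f ewf].
  by have := na e erefl; rewrite -ewv anc_parent.
apply: contra (na e erefl) => vf; apply: (anc_trans vf).
by apply: anc_parent; rewrite -ewf.
Qed.

Lemma node_deviation_sib v (t : S v -> R) w : w \in siblings v ->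
  node_deviation t w = x w.
Proof.
move=> wv; apply: node_deviation_out => [|f]; last exact: sibling_not_anc.
by move: wv; rewrite inE => /andP [/eqP].
Qed.

Lemma emerge_dist (y : node_profile) e :
  (forall w, parent w = Some e -> is_dist (y w)) -> is_dist (emerge D y (e := e)).
Proof.
move=> h; have [p_dist _] := D_valid; split=> [k|].
  apply: sumr_ge0 => s _; apply: mulr_ge0; first by have [+ _] := p_dist e s; apply.
  apply: prodr_ge0 => -[w wP] _ /=; have [+ _] : is_dist (y w); last by apply.
  by apply: h; move: (wP); rewrite inE => /eqP.
rewrite exchange_big /=.
under eq_bigr => s _ do rewrite -mulr_suml (proj2 (p_dist e s)) mul1r.
rewrite -(bigA_distr_dffun (fun (w : {w | w \in children (Some e)}) k => y (val w) k)).
apply: big1 => -[w wP] _ /=; have [_ ->] // : is_dist (y w).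
by apply: h; move: (wP); rewrite inE => /eqP.
Qed.

Lemma induced_dist v : is_dist (x v).
Proof.
move: v; apply: (@child_ind N T) => [i|e IH].
  rewrite (_ : x (inl i) = sg i); first exact: sg_mixed.
  by apply: funext => k; rewrite induced_inl.
rewrite (_ : x (inr e) = emerge D x (e := e)); first exact: emerge_dist.
by apply: funext => k; rewrite induced_inr.
Qed.

Lemma node_deviation_dist v (t : S v -> R) w : is_dist t ->
  is_dist (node_deviation t w).
Proof.
move=> ht; move: w; apply: (@child_ind N T) => [i|e IH].
  case: (pselect (inl i = v)) => [ev|nv].
    by case: v / ev t ht => t ht; rewrite node_deviation_same.
  rewrite (_ : node_deviation t (inl i) = sg i); first exact: sg_mixed.
  by apply: funext => k; rewrite node_deviation_inl.
case: (pselect (inr e = v)) => [ev|nv].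
  by case: v / ev t ht IH => t ht _; rewrite node_deviation_same.
rewrite (_ : node_deviation t (inr e) = emerge D (node_deviation t) (e := e)).
  exact: emerge_dist.
by apply: funext => k; rewrite node_deviation_inr.
Qed.

(* Above e, a deviation of a descendant v of e acts as the deviation that it
   induces at e. *)
Lemma node_deviation_above v (t : S v -> R) e w : anc v e -> above e w ->
  node_deviation t w = node_deviation (node_deviation t (inr e)) w.
Proof.
move=> ve; move: w; apply: (@child_ind N T) => [i|f IH] ab; apply: funext => k.
  by rewrite !node_deviation_inl //; apply: above_neq ab.
case: (eqVneq f e) => [efe|nfe].
  by subst f; rewrite node_deviation_same.
have nv := above_neq ve ab.
have nfe' : inr f <> inr e :> node T by case=> h; rewrite h eqxx in nfe.
case: (boolP (anc (inr e) f)) => ef.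
  rewrite !node_deviation_inr //; apply: eq_bigr => s _; congr (_ * _).
  apply: eq_bigr => -[w wP] _ /=; have wf : parent w = Some f.
    by move: (wP); rewrite inE => /eqP.
  by rewrite IH //; right; exists f.
rewrite !node_deviation_out // => g [<-] //.
apply/negP => vf; case: (anc_comparable ve vf) => [h|h|h].
- by rewrite h eqxx in nfe.
- by rewrite h in ef.
- by have := above_not_desc ab erefl; rewrite h.
Qed.

Lemma own_utility_eq (y z : node_profile) v : y v = z v ->
  (forall w, w \in siblings v -> y w = z w) -> own_utility D y v = own_utility D z v.
Proof.
move=> hv hs; apply: eq_bigr => k _; apply: eq_bigr => s _; rewrite hv; congr (_ * _).
by apply: eq_bigr => -[w wP] _ /=; rewrite hs.
Qed.

Lemma utility_above (y z : node_profile) e :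
  (forall w, above e w -> y w = z w) -> utility D y (inr e) = utility D z (inr e).
Proof.
move=> h.
(* The claim is generalized from [e] to its ancestors, so that top-down induction applies. *)
suff H v : above e v -> (forall g, anc v g -> anc (inr e) g) -> utility D y v = utility D z v.
  apply: H => //; rewrite /above; case E : (parent _) => [f|]; last by left.
  by right; exists f => //; apply: anc_parent.
move: v; apply: (@anc_ind N T) => v IH ab hv; rewrite !utilityE; congr (_ + _).
  apply: own_utility_eq => [|w]; first exact: h.
  by rewrite inE => /andP [_ /eqP pw]; apply: h; rewrite /above pw.
apply: eq_bigr => -[f vf] _ /=; congr (_ * _); apply: IH => // [|g fg].
  rewrite /above; case E : (parent _) => [g|]; last by left.
  by right; exists g => //; apply: hv; apply: anc_trans vf _; apply: anc_parent.
by apply: hv; apply: anc_trans vf fg.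
Qed.

Definition payoff v (k : S v) : R :=
  \sum_(s : jprof A B (siblings v)) own D k s * \prod_w x (val w) (s w).

Lemma own_utility_payoff (y : node_profile) v :
  (forall w, w \in siblings v -> y w = x w) ->
  own_utility D y v = \sum_k y v k * payoff k.
Proof.
move=> hs; apply: eq_bigr => k _; rewrite /payoff mulr_sumr; apply: eq_bigr => s _.
rewrite [_ * y v k]mulrC -mulrA; congr (_ * (_ * _)).
by apply: eq_bigr => -[w wP] _ /=; rewrite hs.
Qed.

(** A linear function on a simplex with a maximum at an interior point is constant: the gaps
    [m - g l] are nonnegative and their average with positive weights is 0. *)
Lemma dist_max_const (K : finType) (g p : K -> R) : is_dist p ->
  (forall k, 0 < p k) ->
  (forall t, is_dist t -> \sum_k t k * g k <= \sum_k p k * g k) ->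
  forall k, g k = \sum_l p l * g l.
Proof.
move=> [_ p1] p_gt0 hmax k; set m := \sum_l p l * g l.
have le l : g l <= m.
  have := hmax (fun i => (i == l)%:R); rewrite (bigD1 l) //= eqxx mul1r big1; last first.
    by move=> i /negPf ->; rewrite mul0r.
  rewrite addr0; apply; split=> [i|]; first exact: ler0n.
  by rewrite (bigD1 l) //= eqxx big1 ?addr0 // => i /negPf ->.
have z : \sum_l p l * (m - g l) = 0.
  under eq_bigr do rewrite mulrBr.
  by rewrite sumrB -mulr_suml p1 mul1r subrr.
move/eqP: z; rewrite psumr_eq0 => [/allP /(_ k)|l _]; last first.
  by apply: mulr_ge0; [apply: ltW | rewrite subr_ge0].
rewrite mem_index_enum mulf_eq0 gt_eqF //= subr_eq0 => /(_ isT) /eqP.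
by [].
Qed.

Lemma indifference v :
  (forall w (k : S w), 0 < x w k) ->
  (forall w t, is_dist t -> utility D (node_deviation (v := w) t) w <= utility D x w) ->
  forall k : S v, payoff k = \sum_l x v l * payoff l.
Proof.
move=> x_gt0 opt.
(* The second conjunct, that no deviation of [v] changes its utility, is what descendants of [v]
   need in the induction. *)
suff H : (forall k : S v, payoff k = \sum_l x v l * payoff l) /\
   forall t, is_dist t -> utility D (node_deviation (v := v) t) v = utility D x v.
  by case: H.
move: v; apply: (@anc_ind N T) => v IH.
have anc_eq t : is_dist t -> utility D (node_deviation (v := v) t) v =
    \sum_k t k * payoff k + \sum_(e : {e | anc v e}) gam D e * utility D x (inr (val e)).
  move=> ht; rewrite utilityE own_utility_payoff ?node_deviation_same; last first.
    by move=> w; apply: node_deviation_sib.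
  congr (_ + _); apply: eq_bigr => -[e ve] _ /=; congr (_ * _).
  (* For the utility of [e], the deviation of [v] is a deviation of [e] itself, which has no effect
     by induction. *)
  rewrite (@utility_above _ (node_deviation (node_deviation t (inr e)))).
    by have [_ ->] := IH e ve => //; apply: node_deviation_dist.
  by move=> w; apply: node_deviation_above.
have xE : utility D x v =
    \sum_k x v k * payoff k + \sum_(e : {e | anc v e}) gam D e * utility D x (inr (val e)).
  by rewrite utilityE own_utility_payoff.
have const (k : S v) : payoff k = \sum_l x v l * payoff l.
  move: k; apply: dist_max_const => //; first exact: induced_dist.
  by move=> t ht; have := opt v t ht; rewrite anc_eq // xE lerD2r.
split=> // t ht; rewrite anc_eq // xE; congr (_ + _).
under eq_bigr do rewrite const.
by rewrite -mulr_suml (proj2 ht) mul1r.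
Qed.

End Deviations.

(** The Nash property gives optimality at the leaves, where utilities are those of the game, and
    hierarchical perfection gives it at the emergent players. *)
Lemma equilibrium_indifference (R : realType) (N : nat) (T : tree N)
    (A : 'I_N -> finType) (B : emergent T -> finType) (D : ent R A B)
    (u : game R A) (sg : profile R A) :
  ent_on u D -> nash u sg -> hier_perfect D sg -> ent_totally_mixed D sg ->
  forall v (k l : strat A B v), payoff D sg k = payoff D sg l.
Proof.
move=> [valid hu] [mixed nsh] hp [tm etm] v k l.
suff h : forall k : strat A B v, payoff D sg k = \sum_l @induced _ _ _ _ _ D sg v l * payoff D sg l.
  by rewrite h [RHS]h.
apply: indifference => // [[i|e] m|[i|e] t ht].
- by rewrite induced_inl.
- exact: etm.
- have e : node_deviation D sg (v := inl i) t = induced D (dfwith sg t).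
    rewrite /node_deviation /induced; congr eval.
    apply: functional_extensionality_dep => -[j|f].
      case: (eqVneq i j) => [ij|nij].
        by case: j / ij; rewrite /= !dfwith_in.
      by rewrite /= !dfwith_out //; apply/eqP => -[h]; rewrite h eqxx in nij.
    by rewrite dfwith_out.
  rewrite e !hu //; first exact: nsh.
  move=> j; case: (eqVneq i j) => [ij|nij].
    by case: j / ij; rewrite dfwith_in.
  by rewrite dfwith_out.
exact: hp.
Qed.

(** * Genericity in the data of the ENT *)

Section GenericData.
Context {R : realType} {N : nat} {T : tree N}.
Context {A : 'I_N -> finType} {B : emergent T -> finType}.
Local Notation S := (strat A B).
Local Notation J := (eqn_index A B).
Hypothesis A_gt0 : forall i, (0 < #|A i|)%N.
Hypothesis B_gt0 : forall e, (0 < #|B e|)%N.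
Hypothesis B_le : forall e,
  (#|B e| <= \prod_(w in children (Some e)) #|strat A B w|)%N.

Lemma strat_gt0 (v : node T) : (0 < #|S v|)%N.
Proof. by case: v => [i|e] /=; [apply: A_gt0 | apply: B_gt0]. Qed.

Lemma card_eqn_index : #|J| = (\sum_v #|S v|.-1)%N.
Proof.
rewrite -sum1_card -(sig_big_dep xpredT (fun _ => xpredT) (fun _ _ => 1%N)) /=.
by apply: eq_bigr => v _; rewrite sum1_card card_ord.
Qed.

Lemma card_jprof (X : {set node T}) : #|jprof A B X| = (\prod_(w in X) #|S w|)%N.
Proof.
rewrite -(bij_eq_card (dffun_of_fprod_bij (fun w : {w | w \in X} => S (val w)))).
by rewrite card_fprod (big_sub (mem X)).
Qed.

(* The parameter 0 is reserved for the form that completes the basis in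
   [pvar_mod_linf]. *)
Definition node_theta (v : node T) (l : nat) : R := (pickle (v, l)).+1%:R.

Definition theta (a : J) : R := node_theta (tag a) (tagged a).

Lemma theta_inj : injective theta.
Proof.
move=> [v l] [v' l'] /eqP; rewrite /theta /node_theta eqr_nat eqSS => /eqP.
move=> /(pcan_inj pickleK) /= [ev]; case: v' / ev l' => l' el.
by congr existT; apply: val_inj.
Qed.

Lemma theta_neq0 a : theta a != 0.
Proof. by rewrite pnatr_eq0. Qed.

Definition base_strat (v : node T) : S v := enum_val (Ordinal (strat_gt0 v)).

Lemma eqn_strat_subproof (a : J) : ((tagged a).+1 < #|S (tag a)|)%N.
Proof. by rewrite -(prednK (strat_gt0 _)) ltnS; apply: ltn_ord. Qed.

(** The equation [(v, l)] compares strategy number [l + 1] of [v] with strategy number 0, hence the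
    successor. *)
Definition eqn_strat (a : J) : S (tag a) := enum_val (Ordinal (eqn_strat_subproof a)).

Lemma surjective_kernel e : exists p : S (inr e) -> jprof A B (children (Some e)) -> R,
  (forall s, is_dist (fun k => p k s)) /\
  \rank (\matrix_(k, s) p (enum_val k) (enum_val s) :
     'M_(#|S (inr e)|, #|jprof A B (children (Some e))|)) =
    minn #|S (inr e)| #|jprof A B (children (Some e))|.
Proof.
have le : (#|S (inr e)| <= #|jprof A B (children (Some e))|)%N.
  by rewrite card_jprof; apply: B_le.
pose psi k := enum_val (widen_ord le (enum_rank k)).
have psiI : injective psi.
  by move=> k l /enum_val_inj /(congr1 val) /= /val_inj /enum_rank_inj.
pose phi s := odflt (base_strat (inr e)) [pick k | psi k == s].
have phiK k : phi (psi k) = k.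
  rewrite /phi; case: pickP => [l /eqP /psiI -> //|/(_ k)]; by rewrite eqxx.
exists (fun k s => (k == phi s)%:R); split=> [s|].
  split=> [k|]; first exact: ler0n.
  by rewrite (bigD1 (phi s)) //= eqxx big1 ?addr0 // => k /negPf ->.
rewrite (minn_idPl le); apply/eqP.
change (is_true (row_free (\matrix_(k < #|S (inr e)|, s < #|jprof A B (children (Some e))|)
  (enum_val k == phi (enum_val s))%:R : 'M[R]_(_, _)))); apply/row_freeP.
exists (\matrix_(s, k) (enum_val s == psi (enum_val k))%:R).
apply/matrixP => k l; rewrite !mxE (bigD1 (enum_rank (psi (enum_val l)))) //=.
rewrite !mxE enum_rankK eqxx mulr1 phiK (inj_eq enum_val_inj) big1 ?addr0 // => s ns.
rewrite !mxE [X in _ * (nat_of_bool X)%:R](_ : _ = false) ?mulr0 //.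
by apply: contraNF ns => /eqP <-; rewrite enum_valK.
Qed.

(** This valid ENT realizes the product system and witnesses that the exceptional set is proper. *)
Lemma special_ent : exists2 D : ent R A B, ent_valid D &
  forall (a : J) (s : jprof A B (siblings (tag a))),
    own D (eqn_strat a) s - own D (base_strat (tag a)) s =
      \prod_w theta a ^+ enum_rank (s w).
Proof.
have [p hp] : exists p : forall e, S (inr e) -> jprof A B (children (Some e)) -> R,
    forall e, (forall s, is_dist (fun k => p e k s)) /\
  \rank (\matrix_(k, s) p e (enum_val k) (enum_val s) :
     'M_(#|S (inr e)|, #|jprof A B (children (Some e))|)) =
    minn #|S (inr e)| #|jprof A B (children (Some e))|.
  exact: fin_all_exists surjective_kernel.
exists (Ent (fun v k s => if val (enum_rank k) is l.+1
    then \prod_w node_theta v l ^+ enum_rank (s w) else 0) (fun _ _ => 0) p).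
  by split=> e; have [] := hp e.
by move=> a s; rewrite /= /base_strat /eqn_strat !enum_valK subr0.
Qed.

Lemma generic_equilibria_bound :
  exists2 P : {mpoly R[#|@Defs.coord N T A B|]},
    exists D : ent R A B, ent_valid D /\ P.@[fun i => coords D (enum_val i)] != 0 &
    forall (D : ent R A B), ent_valid D -> P.@[fun i => coords D (enum_val i)] != 0 ->
    forall u, ent_on u D -> forall n (sg : 'I_n -> profile R A), injective sg ->
      (forall i, [/\ nash u (sg i), totally_mixed (sg i),
         hier_perfect D (sg i) & ent_totally_mixed D (sg i)]) ->
      (n <= #|assignments S (fun a : J => siblings (tag a))|)%N.
Proof.
have [D0 D0_valid hD0] := special_ent.
pose W (a : J) := siblings (tag a).
pose cX v (k : S v) (s : jprof A B (siblings v)) : {mpoly R[#|@Defs.coord N T A B|]} :=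
  'X_(enum_rank (inl (inl (Tagged (fun v => (S v * jprof A B (siblings v))%type) (k, s))) : @Defs.coord N T A B)).
(* As polynomials in the data, the coefficients of the indifference equations are differences of two
   coordinates. *)
pose cf (a : J) (s : prof S (W a)) := cX _ (eqn_strat a) s - cX _ (base_strat (tag a)) s.
have cfE D a s : (cf a s).@[fun i => coords D (enum_val i)] =
    own D (eqn_strat a) s - own D (base_strat (tag a)) s.
  by rewrite mevalB !mevalXU !enum_rankK.
have [|P P0 hP] := generic_solution_bound (cf := cf)
  (x0 := fun i => coords D0 (enum_val i)) theta_inj theta_neq0 strat_gt0 card_eqn_index.
  by move=> a s; rewrite cfE hD0.
exists P; first by exists D0.
move=> D D_valid PD u uD n sg sg_inj eqm.
apply: (hP _ PD n (fun i => induced D (sg i))) => [i w|i j nij|i a].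
- have [[mixed _] _ _ _] := eqm i.
  by have [_] := induced_dist D_valid mixed w.
(* Distinct profiles already differ at a player, so they induce distinct points. *)
- apply: contrapT => h; move/negP: nij; apply; apply/eqP/sg_inj.
  apply: functional_extensionality_dep => p; apply: funext => k.
  rewrite -!(induced_inl D); apply: contrapT => ne; apply: h.
  by exists (inl p), k; apply/eqP.
have [nsh _ hp etm] := eqm i.
under eq_bigr do rewrite cfE mulrBl.
rewrite sumrB; apply/eqP; rewrite subr_eq0; apply/eqP.
exact: (equilibrium_indifference uD nsh hp etm).
Qed.

End GenericData.

(** * Counting the equilibria *)

Lemma card_eq_of_bounded (X : Type) (E : set X) (b : nat) :
  (forall n (f : 'I_n -> X), injective f -> (forall i, E (f i)) -> (n <= b)%N) ->
  exists2 n, (E #= `I_n)%classic%card & (n <= b)%N.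
Proof.
move=> h.
have le n : (`I_n #<= E)%classic%card -> (n <= b)%N.
  move=> /card_leP [f].
  pose g (i : 'I_n) := f (SigSub (mem_set (ltn_ord i : `I_n%classic (val i)))).
  apply: (h n (fun i => val (g i))) => [i j /val_inj e|i].
    have e' := 'inj_f (mem_setT _) (mem_setT _) e.
    by apply: val_inj; apply: (congr1 val e').
  exact: set_mem (valP (g i)).
have [[n En]|inf] := pselect (finite_set E).
  exists n => //; apply: le; by move: En; rewrite card_eq_le => /andP [].
(* An infinite set would contain [b.+1] distinct elements. *)
have /infiniteP nE := inf.
have : (b.+1 <= b)%N; last by rewrite ltnn.
apply: le; apply: card_le_trans nE; exact: subset_card_le.
Qed.

Theorem theorem8 (R : realType) (N : nat) (N_gt0 : (0 < N)%N) (T : tree N)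
    (A : 'I_N -> finType) (B : emergent T -> finType)
    (A_gt0 : forall i, (0 < #|A i|)%N)
    (B_gt0 : forall e, (0 < #|B e|)%N)
    (B_le : forall e,
      (#|B e| <= \prod_(w in children (Some e)) #|strat A B w|)%N) :
  generically (fun D : ent R A B =>
    forall u : game R A, ent_on u D ->
    exists2 n : nat,
      ([set sg : profile R A |
          [/\ nash u sg, totally_mixed sg,
              hier_perfect D sg & ent_totally_mixed D sg]]
        #= `I_n)%classic%card
      & n%:R <= permanent (bernstein_mx A B R)).
Proof.
have [P [D0 [D0_valid PD0]] hP] := @generic_equilibria_bound R N T A B A_gt0 B_gt0 B_le.
(* The exceptional set is the zero set of the single polynomial [P]. *)
exists [set x | all (fun p => p.@[fun i => x (enum_val i)] == 0) [:: P]]%classic.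
split; first by exists [:: P].
  by exists D0; split=> //=; rewrite andbT; apply/negP.
move=> D D_valid /= /negP; rewrite andbT => PD u uD.
set E := [set sg | _]%classic.
have [n En le] := @card_eq_of_bounded _ E _ (hP D D_valid PD u uD).
exists n => //; have := assignments_le_permanent R A B.
by apply: le_trans; rewrite ler_nat.
Qed.
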